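(* Let $\mathfrak S$ be a $k$-linear Grothendieck category such that $(C,-):\mathfrak S\to\mathfrak S$ is exact. Let $(A,C,\psi)$ be an entwining structure over $k$ with $A$ finite dimensional over $k$, and let $\varphi:A^\ast\otimes C\to A$ be a normalized cointegral for $(A,C,\psi)$. Then the forgetful functors ${}^{[C,-]}\mathcal F:{}^{[C,-]}_{A}\mathfrak S(\psi)\to{}^{[C,-]}\mathfrak S$ and $\mathcal F^C:\mathfrak S_A^C(\psi)\to\mathfrak S^C$ are semisimple and Maschke functors.
   Context: Conventions. $k$ is a field of characteristic zero and $\otimes=\otimes_k$. For $\mathcal M\in\mathfrak S$, $\mathcal M\otimes-:Mod_k\to\mathfrak S$ is the left adjoint of $\mathfrak S(\mathcal M,-):\mathfrak S\to Mod_k$; this gives a bifunctor, exact and colimit preserving in both variables, and we also write $V\otimes\mathcal M$ for $\mathcal M\otimes V$. For $V\in Mod_k$, $(V,-):\mathfrak S\to\mathfrak S$ is the right adjoint of $V\otimes-$; this is a bifunctor $Mod_k^{op}\times\mathfrak S\to\mathfrak S$ with $(k,\mathcal M)=\mathcal M$ and $(V,(V',\mathcal M))\cong(V'\otimes V,\mathcal M)$. Write $(V_1,\dots,V_n,\mathcal M):=(V_1,(V_2,\dots(V_n,\mathcal M)))=(V_n\otimes\cdots\otimes V_1,\mathcal M)$. A linear map $f:V_m\otimes\cdots\otimes V_1\to W_n\otimes\cdots\otimes W_1$ induces $(f,\mathcal M):(W_1,\dots,W_n,\mathcal M)\to(V_1,\dots,V_m,\mathcal M)$; an object written in a slot of a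 morphism denotes the identity in that slot. $(A,\mu,\eta)$ is a $k$-algebra and $(C,\Delta,\epsilon)$ a $k$-coalgebra. An entwining structure $(A,C,\psi)$ is a linear map $\psi:C\otimes A\to A\otimes C$ with $\psi(C\otimes\mu)=(\mu\otimes C)(A\otimes\psi)(\psi\otimes A)$, $\psi(C\otimes\eta)=\eta\otimes C$, $(A\otimes\Delta)\psi=(\psi\otimes C)(C\otimes\psi)(\Delta\otimes A)$, $(A\otimes\epsilon)\psi=\epsilon\otimes A$. Let $coev_A:k\to A\otimes A^\ast$, $r\mapsto r\sum_i a_i\otimes a_i^\ast$, for a basis $\{a_i\}$ of $A$ with dual basis $\{a_i^\ast\}$. A linear map $\varphi:A^\ast\otimes C\to A$ is a normalized cointegral for $(A,C,\psi)$ if (i) $(A\otimes\psi)\circ(\psi\otimes\varphi)\circ(C\otimes coev_A\otimes C)\circ\Delta=(A\otimes\varphi\otimes C)\circ(coev_A\otimes\Delta)$; (ii) $(A\otimes\mu)\circ(A\otimes\varphi\otimes A)\circ(coev_A\otimes C\otimes A)=(\mu\otimes\varphi)\circ(A\otimes coev_A\otimes C)\circ\psi$; (iii) $\mu\circ(A\otimes\varphi)\circ(coev_A\otimes C)=\eta\circ\epsilon$. A left $A$-module object is $(\mathcal M,\mu_{\mathcal M}:\mathcal M\to(A,\mathcal M))$ with $(\mu,\mathcal M)\mu_{\mathcal M}=(A,\mu_{\mathcal M})\mu_{\mathcal M}$, $(\eta,\mathcal M)\mu_{\mathcal M}=id$. ${}^{[C,-]}\mathfrak S$ is the category of left $C$-contramodule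 objects $(\mathcal M,\pi_{\mathcal M}:(C,\mathcal M)\to\mathcal M)$: $\pi_{\mathcal M}(\epsilon,\mathcal M)=id$, $\pi_{\mathcal M}(\Delta,\mathcal M)=\pi_{\mathcal M}(C,\pi_{\mathcal M})$. ${}^{[C,-]}_{A}\mathfrak S(\psi)$ is the category of triples $(\mathcal M,\pi_{\mathcal M},\mu_{\mathcal M})$ with both structures such that $\mu_{\mathcal M}\pi_{\mathcal M}=(A,\pi_{\mathcal M})(\psi,\mathcal M)(C,\mu_{\mathcal M})$. Both are abelian (as $(C,-)$ is exact), with kernels and cokernels computed in $\mathfrak S$. $\mathfrak S^C$ is the category of right $C$-comodule objects $(\mathcal M,\Delta_{\mathcal M}:\mathcal M\to\mathcal M\otimes C)$ (coassociative, counital); right $A$-module objects are $(\mathcal M,\mu_{\mathcal M}:\mathcal M\otimes A\to\mathcal M)$ (associative, unital). $\mathfrak S_A^C(\psi)$ is the category of triples $(\mathcal M,\Delta_{\mathcal M},\mu_{\mathcal M})$ with both structures such that $\Delta_{\mathcal M}\mu_{\mathcal M}=(\mu_{\mathcal M}\otimes C)(\mathcal M\otimes\psi)(\Delta_{\mathcal M}\otimes A)$. Both are abelian with kernels and cokernels computed in $\mathfrak S$. In all cases morphisms preserve the structures. Let $\mathcal T:\mathcal E\to\mathcal D$ be a functor between abelian categories. $\mathcal T$ is semisimple if it reflects split exact sequences: a short exact sequence $0\to\mathcal N\to\mathcal M\to\mathcal P\to0$ in $\mathcal E$ is split exact whenever $0\to\mathcal T(\mathcal N)\to\mathcal T(\mathcal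 M)\to\mathcal T(\mathcal P)\to0$ is split exact in $\mathcal D$. $\mathcal T$ is Maschke if for all morphisms $i:\mathcal M'\to\mathcal M$ and $f:\mathcal M'\to\mathcal N$ in $\mathcal E$ such that $\mathcal T(i)$ is a split monomorphism in $\mathcal D$, there exists $g:\mathcal M\to\mathcal N$ with $g\circ i=f$. *)

(* Defs.v *)
From HB Require Import structures.
From mathcomp Require Import all_boot all_algebra.
From mathcomp Require Import boolp.
Set Implicit Arguments. Unset Strict Implicit. Unset Printing Implicit Defensive.
Import GRing.Theory.
Local Open Scope ring_scope.
Local Open Scope quotient_scope.

Definition bilin (k : fieldType) (U V W : lmodType k) (f : U -> V -> W) : Prop :=
  (forall v, linear (f^~ v)) /\ (forall u, linear (f u)).

Section TensorProduct.
Context {k : fieldType}.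
Section Construction.
Variables U V : lmodType k.

Definition tens_eval (W : lmodType k) (f : U -> V -> W) (s : seq (U * V)) : W :=
  \sum_(p <- s) f p.1 p.2.

(* A list of pairs stands for the sum of the corresponding pure tensors; two
   lists are identified when no bilinear map can tell them apart. *)
Definition tens_rel (s t : seq (U * V)) : bool :=
  `[< forall (W : lmodType k) (f : U -> V -> W),
        bilin f -> tens_eval f s = tens_eval f t >].

Lemma tens_rel_refl : reflexive tens_rel.
Proof. by move=> s; apply/asboolP. Qed.

Lemma tens_rel_sym : symmetric tens_rel.
Proof.
by move=> s t; apply/asboolP/asboolP => h W f hf; rewrite (h _ _ hf).
Qed.

Lemma tens_rel_trans : transitive tens_rel.
Proof.
move=> t s r /asboolP h1 /asboolP h2; apply/asboolP => W f hf.
by rewrite (h1 _ _ hf) (h2 _ _ hf).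
Qed.

Canonical tens_equiv := EquivRel tens_rel tens_rel_refl tens_rel_sym tens_rel_trans.

Definition tensor := {eq_quot tens_equiv}.
HB.instance Definition _ := Choice.on tensor.
HB.instance Definition _ := EqQuotient.on tensor.

Definition tens_val (W : lmodType k) (f : U -> V -> W) (x : tensor) : W :=
  tens_eval f (repr x).

Lemma tens_valE (W : lmodType k) (f : U -> V -> W) s :
  bilin f -> tens_val f (\pi_tensor s) = tens_eval f s.
Proof.
move=> hf; have : repr (\pi_tensor s) = s %[mod tensor] by rewrite reprK.
by move/eqmodP => /asboolP; exact.
Qed.

Lemma tensP (x y : tensor) :
  (forall (W : lmodType k) (f : U -> V -> W), bilin f -> tens_val f x = tens_val f y) ->
  x = y.
Proof.
move=> h; rewrite -[x]reprK -[y]reprK; apply/eqmodP/asboolP => W f hf.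
exact: h.
Qed.

Definition tens_zero : tensor := \pi_tensor [::].
Definition tens_add (x y : tensor) : tensor := \pi_tensor (repr x ++ repr y).
Definition tens_scale (a : k) (x : tensor) : tensor :=
  \pi_tensor [seq (a *: p.1, p.2) | p <- repr x].
Definition tens_opp : tensor -> tensor := tens_scale (-1).

Section Eval.
Variables (W : lmodType k) (f : U -> V -> W) (hf : bilin f).

Lemma tens_val0 : tens_val f tens_zero = 0.
Proof. by rewrite tens_valE // /tens_eval big_nil. Qed.

Lemma tens_valD x y : tens_val f (tens_add x y) = tens_val f x + tens_val f y.
Proof. by rewrite tens_valE // /tens_eval big_cat. Qed.

Lemma tens_valZ a x : tens_val f (tens_scale a x) = a *: tens_val f x.
Proof.
rewrite tens_valE // /tens_eval big_map scaler_sumr; apply: eq_bigr => p _ /=.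
by have /scalable_linear -> := hf.1 p.2.
Qed.

Lemma tens_valN x : tens_val f (tens_opp x) = - tens_val f x.
Proof. by rewrite tens_valZ scaleN1r. Qed.
End Eval.

Fact tens_addA : associative tens_add.
Proof. by move=> x y z; apply: tensP => W f hf; rewrite !tens_valD // addrA. Qed.
Fact tens_addC : commutative tens_add.
Proof. by move=> x y; apply: tensP => W f hf; rewrite !tens_valD // addrC. Qed.
Fact tens_add0 : left_id tens_zero tens_add.
Proof. by move=> x; apply: tensP => W f hf; rewrite tens_valD // tens_val0 // add0r. Qed.
Fact tens_addN : left_inverse tens_zero tens_opp tens_add.
Proof.
by move=> x; apply: tensP => W f hf; rewrite tens_valD // tens_valN // tens_val0 // addNr.
Qed.
HB.instance Definition _ :=
  GRing.isZmodule.Build tensor tens_addA tens_addC tens_add0 tens_addN.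

Fact tens_scaleA a b x : tens_scale a (tens_scale b x) = tens_scale (a * b) x.
Proof. by apply: tensP => W f hf; rewrite !tens_valZ // scalerA. Qed.
Fact tens_scale1 : left_id 1 tens_scale.
Proof. by move=> x; apply: tensP => W f hf; rewrite tens_valZ // scale1r. Qed.
Fact tens_scaleDr : right_distributive tens_scale +%R.
Proof.
move=> a x y; apply: tensP => W f hf.
by rewrite tens_valZ // !tens_valD // !tens_valZ // scalerDr.
Qed.
Fact tens_scaleDl x : {morph tens_scale^~ x : a b / a + b}.
Proof.
move=> a b; apply: tensP => W f hf.
by rewrite tens_valD // !tens_valZ // scalerDl.
Qed.
HB.instance Definition _ :=
  GRing.Zmodule_isLmodule.Build k tensor tens_scaleA tens_scale1 tens_scaleDr tens_scaleDl.

Definition tpure (u : U) (v : V) : tensor := \pi_tensor [:: (u, v)].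

Lemma tens_val_pure (W : lmodType k) (f : U -> V -> W) u v :
  bilin f -> tens_val f (tpure u v) = f u v.
Proof. by move=> hf; rewrite tens_valE // /tens_eval big_seq1. Qed.

Lemma tpure_bilin : bilin tpure.
Proof.
by split=> [v a x y|u a x y]; apply: tensP => W f hf;
  rewrite tens_valD // tens_valZ // !tens_val_pure //; apply hf.
Qed.

Lemma tens_val_linear (W : lmodType k) (f : U -> V -> W) : bilin f -> linear (tens_val f).
Proof. by move=> hf a x y; rewrite tens_valD // tens_valZ. Qed.

End Construction.

Notation "U \ox V" := (tensor U V) (at level 40, left associativity).

Definition tlift (U V W : lmodType k) (f : U -> V -> W) (hf : bilin f) :
  {linear U \ox V -> W} :=
  HB.pack (tens_val f) (GRing.isLinear.Build k (U \ox V) W *:%R _ (tens_val_linear hf)).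

Lemma tlift_pure (U V W : lmodType k) (f : U -> V -> W) (hf : bilin f) u v :
  tlift hf (tpure u v) = f u v.
Proof. exact: tens_val_pure. Qed.

Lemma tens_spanned (U V : lmodType k) (x : U \ox V) :
  x = \sum_(p <- repr x) tpure p.1 p.2.
Proof.
rewrite -{1}[x]reprK; elim: (repr x) => [|[u v] s ih]; first by rewrite big_nil.
rewrite big_cons -ih; apply: tensP => W f hf.
by rewrite tens_valD // tens_val_pure // !tens_valE // /tens_eval big_cons.
Qed.

Lemma tens_ext (U V W : lmodType k) (f g : {linear U \ox V -> W}) :
  (forall u v, f (tpure u v) = g (tpure u v)) -> f =1 g.
Proof.
by move=> h x; rewrite (tens_spanned x) !linear_sum; apply: eq_bigr => p _; exact: h.
Qed.

Lemma tlift_lin (U V W : lmodType k) (f g h : U -> V -> W) (hf : bilin f)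
    (hg : bilin g) (hh : bilin h) a x :
  (forall u v, f u v = a *: g u v + h u v) ->
  tlift hf x = a *: tlift hg x + tlift hh x.
Proof.
move=> e; rewrite /= /tens_val /tens_eval scaler_sumr -big_split /=.
by apply: eq_bigr => p _; rewrite e.
Qed.

Lemma tpureDl (U V : lmodType k) a (u u' : U) (v : V) :
  tpure (a *: u + u') v = a *: tpure u v + tpure u' v.
Proof. exact: (tpure_bilin U V).1. Qed.

Lemma tpureDr (U V : lmodType k) a (u : U) (v v' : V) :
  tpure u (a *: v + v') = a *: tpure u v + tpure u v'.
Proof. exact: (tpure_bilin U V).2. Qed.

Fact tmap_bilin (U U' V V' : lmodType k) (f : {linear U -> U'}) (g : {linear V -> V'}) :
  bilin (fun u v => tpure (f u) (g v)).
Proof. by split=> [v|u] a x y; rewrite linearP (tpureDl, tpureDr). Qed.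
Definition tmap (U U' V V' : lmodType k) (f : {linear U -> U'}) (g : {linear V -> V'}) :
  {linear U \ox V -> U' \ox V'} := tlift (tmap_bilin f g).

Fact tassoc_bilin1 (U V W : lmodType k) (w : W) :
  bilin (fun (u : U) (v : V) => tpure u (tpure v w)).
Proof. by split=> [v|u] a x y; rewrite !(tpureDl, tpureDr). Qed.
Fact tassoc_bilin (U V W : lmodType k) :
  bilin (fun (x : U \ox V) (w : W) => tlift (tassoc_bilin1 U V w) x).
Proof.
split=> [w a x y|x a w w']; first by rewrite linearP.
by apply: tlift_lin => u v; rewrite !tpureDr.
Qed.
Definition tassoc (U V W : lmodType k) : {linear (U \ox V) \ox W -> U \ox (V \ox W)} :=
  tlift (tassoc_bilin U V W).

Fact tassocV_bilin1 (U V W : lmodType k) (u : U) :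
  bilin (fun (v : V) (w : W) => tpure (tpure u v) w).
Proof. by split=> [v|w] a x y; rewrite !(tpureDl, tpureDr). Qed.
Fact tassocV_bilin (U V W : lmodType k) :
  bilin (fun (u : U) (y : V \ox W) => tlift (tassocV_bilin1 V W u) y).
Proof.
split=> [y a u u'|u a y y']; last by rewrite linearP.
by apply: tlift_lin => v w; rewrite !tpureDl.
Qed.
Definition tassocV (U V W : lmodType k) : {linear U \ox (V \ox W) -> (U \ox V) \ox W} :=
  tlift (tassocV_bilin U V W).

Lemma tmap_pure (U U' V V' : lmodType k) (f : {linear U -> U'}) (g : {linear V -> V'}) u v :
  tmap f g (tpure u v) = tpure (f u) (g v).
Proof. exact: tlift_pure. Qed.
Lemma tassoc_pure (U V W : lmodType k) (u : U) (v : V) (w : W) :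
  tassoc U V W (tpure (tpure u v) w) = tpure u (tpure v w).
Proof. by rewrite !tlift_pure. Qed.
Lemma tassocV_pure (U V W : lmodType k) (u : U) (v : V) (w : W) :
  tassocV U V W (tpure u (tpure v w)) = tpure (tpure u v) w.
Proof. by rewrite !tlift_pure. Qed.

Fact tunitl_bilin (V : lmodType k) : bilin (fun (r : k^o) (v : V) => r *: v).
Proof.
by split=> [v a r s|r a v w]; rewrite ?scalerDl ?scalerA // scalerDr !scalerA mulrC.
Qed.
Definition tunitl (V : lmodType k) : {linear k^o \ox V -> V} := tlift (tunitl_bilin V).
Fact tunitlV_linear (V : lmodType k) : linear (fun v : V => tpure (1 : k^o) v).
Proof. by move=> a x y; rewrite tpureDr. Qed.
Definition tunitlV (V : lmodType k) : {linear V -> k^o \ox V} :=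
  HB.pack (fun v : V => tpure (1 : k^o) v)
    (GRing.isLinear.Build k V (k^o \ox V) *:%R _ (@tunitlV_linear V)).

Fact tunitr_bilin (V : lmodType k) : bilin (fun (v : V) (r : k^o) => r *: v).
Proof. by split; apply tunitl_bilin. Qed.
Definition tunitr (V : lmodType k) : {linear V \ox k^o -> V} := tlift (tunitr_bilin V).
Fact tunitrV_linear (V : lmodType k) : linear (fun v : V => tpure v (1 : k^o)).
Proof. by move=> a x y; rewrite tpureDl. Qed.
Definition tunitrV (V : lmodType k) : {linear V -> V \ox k^o} :=
  HB.pack (fun v : V => tpure v (1 : k^o))
    (GRing.isLinear.Build k V (V \ox k^o) *:%R _ (@tunitrV_linear V)).

End TensorProduct.

Notation "U \ox V" := (tensor U V) (at level 40, left associativity).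

Section Linear.
Context {k : fieldType}.
Definition linid (V : lmodType k) : {linear V -> V} := idfun.

Record algebra_on (A : lmodType k) := AlgebraOn {
  amul : {linear A \ox A -> A};
  aone : {linear k^o -> A};
  amulA : amul \o tmap amul (linid A) =1
          amul \o tmap (linid A) amul \o tassoc A A A;
  amul1 : amul \o tmap aone (linid A) \o tunitlV A =1 id;
  amulr1 : amul \o tmap (linid A) aone \o tunitrV A =1 id
}.

Record coalgebra_on (C : lmodType k) := CoalgebraOn {
  cmul : {linear C -> C \ox C};
  ceps : {linear C -> k^o};
  cmulA : tassoc C C C \o tmap cmul (linid C) \o cmul =1 tmap (linid C) cmul \o cmul;
  cmul1 : tunitl C \o tmap ceps (linid C) \o cmul =1 id;
  cmulr1 : tunitr C \o tmap (linid C) ceps \o cmul =1 id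
}.

Record entwining (A C : lmodType k) (a : algebra_on A) (c : coalgebra_on C) := Entwining {
  ent :> {linear C \ox A -> A \ox C};
  ent_mul : ent \o tmap (linid C) (amul a) \o tassoc C A A =1
            tmap (amul a) (linid C) \o tassocV A A C \o tmap (linid A) ent
              \o tassoc A C A \o tmap ent (linid A);
  ent_one : ent \o tmap (linid C) (aone a) \o tunitrV C =1
            tmap (aone a) (linid C) \o tunitlV C;
  ent_comul : tmap (linid A) (cmul c) \o ent =1
              tassoc A C C \o tmap ent (linid C) \o tassocV C A C
                \o tmap (linid C) ent \o tassoc C C A \o tmap (cmul c) (linid A);
  ent_eps : tunitr A \o tmap (linid A) (ceps c) \o ent =1
            tunitl A \o tmap (ceps c) (linid A)
}.

Definition dual (A : vectType k) : vectType k := 'Hom(A, k^o).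

Definition coev_elt (A : vectType k) : A \ox dual A :=
  \sum_(i < \dim {:A}) tpure (vbasis {:A})`_i
    (linfun (coord (vbasis {:A}) i : A -> k^o) : dual A).

Fact coev_linear (A : vectType k) : linear (fun r : k^o => (r : k) *: coev_elt A).
Proof. by move=> a r s; rewrite scalerDl scalerA. Qed.
Definition coev (A : vectType k) : {linear k^o -> A \ox dual A} :=
  HB.pack (fun r : k^o => (r : k) *: coev_elt A)
    (GRing.isLinear.Build k k^o (A \ox dual A) *:%R _ (@coev_linear A)).

(* coev_A (x) id_V, with source V = k (x) V and the target bracketed to the right. *)
Definition coevl (A : vectType k) (V : lmodType k) : {linear V -> A \ox (dual A \ox V)} :=
  tassoc A (dual A) V \o tmap (coev A) (linid V) \o tunitlV V.

Record normalized_cointegral (A : vectType k) (C : lmodType k) (a : algebra_on A)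
    (c : coalgebra_on C) (psi : entwining a c) (phi : {linear dual A \ox C -> A}) : Prop :=
  NormalizedCointegral {
  cointegral_comul :
    tmap (linid A) psi \o tassoc A C A \o tmap psi phi \o tassocV C A (dual A \ox C)
      \o tmap (linid C) (coevl A C) \o cmul c =1
    tmap (linid A) (tmap phi (linid C) \o tassocV (dual A) C C)
      \o coevl A (C \ox C) \o cmul c;
  cointegral_mul :
    tmap (linid A) (amul a) \o tmap (linid A) (tmap phi (linid A) \o tassocV (dual A) C A)
      \o coevl A (C \ox A) =1
    tmap (amul a) phi \o tassocV A A (dual A \ox C) \o tmap (linid A) (coevl A C) \o psi;
  cointegral_norm :
    amul a \o tmap (linid A) phi \o coevl A C =1 aone a \o ceps c
}.
End Linear.

Record lincat (k : fieldType) := LinCat {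
  obj :> Type;
  hom : obj -> obj -> lmodType k;
  idm : forall X, hom X X;
  comp : forall X Y Z, hom Y Z -> hom X Y -> hom X Z;
  comp_assoc : forall X Y Z T (h : hom Z T) (g : hom Y Z) (f : hom X Y),
    comp h (comp g f) = comp (comp h g) f;
  comp_idl : forall X Y (f : hom X Y), comp (idm Y) f = f;
  comp_idr : forall X Y (f : hom X Y), comp f (idm X) = f;
  comp_linl : forall X Y Z (f : hom X Y), linear (fun g : hom Y Z => comp g f);
  comp_linr : forall X Y Z (g : hom Y Z), linear (fun f : hom X Y => comp g f)
}.
Arguments hom {k} {l} X Y.
Arguments idm {k} {l} X.
Arguments comp {k} {l} {X Y Z} g f : rename.
Notation "g \oc f" := (comp g f) (at level 45, left associativity).

Section LinearCategories.
Context {k : fieldType}.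
Implicit Types S E D : lincat k.

Definition postcomp S (X Y Z : S) (g : hom Y Z) : {linear hom X Y -> hom X Z} :=
  HB.pack (comp g : hom X Y -> hom X Z)
    (GRing.isLinear.Build k (hom X Y) (hom X Z) *:%R (comp g) (@comp_linr k S X Y Z g)).
Definition precomp S (X Y Z : S) (f : hom X Y) : {linear hom Y Z -> hom X Z} :=
  HB.pack (comp^~ f : hom Y Z -> hom X Z)
    (GRing.isLinear.Build k (hom Y Z) (hom X Z) *:%R (comp^~ f) (@comp_linl k S X Y Z f)).

Definition is_kernel S (K X Y : S) (i : hom K X) (f : hom X Y) : Prop :=
  f \oc i = 0 /\
  forall T (g : hom T X), f \oc g = 0 -> exists! h : hom T K, i \oc h = g.

Definition is_cokernel S (X Y Q : S) (p : hom Y Q) (f : hom X Y) : Prop :=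
  p \oc f = 0 /\
  forall T (g : hom Y T), g \oc f = 0 -> exists! h : hom Q T, h \oc p = g.

Definition monic S (X Y : S) (f : hom X Y) : Prop :=
  forall T (g h : hom T X), f \oc g = f \oc h -> g = h.
Definition epic S (X Y : S) (f : hom X Y) : Prop :=
  forall T (g h : hom Y T), g \oc f = h \oc f -> g = h.
Definition split_mono S (X Y : S) (f : hom X Y) : Prop :=
  exists r : hom Y X, r \oc f = idm X.

Definition short_exact S (N M P : S) (i : hom N M) (p : hom M P) : Prop :=
  is_kernel i p /\ is_cokernel p i.
Definition split_exact S (N M P : S) (i : hom N M) (p : hom M P) : Prop :=
  short_exact i p /\ exists s : hom P M, p \oc s = idm P.

Record abelian S : Prop := Abelian {
  ab_zero : exists Z : S, idm Z = 0;
  ab_biprod : forall X Y : S, exists (B : S) (i : hom X B) (j : hom Y B)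
      (p : hom B X) (q : hom B Y),
    [/\ p \oc i = idm X, q \oc j = idm Y, q \oc i = 0, p \oc j = 0
      & i \oc p + j \oc q = idm B];
  ab_ker : forall (X Y : S) (f : hom X Y), exists (K : S) (i : hom K X), is_kernel i f;
  ab_coker : forall (X Y : S) (f : hom X Y), exists (Q : S) (p : hom Y Q), is_cokernel p f;
  ab_mono : forall (X Y : S) (f : hom X Y),
    monic f -> exists (Z : S) (g : hom Y Z), is_kernel f g;
  ab_epi : forall (X Y : S) (f : hom X Y),
    epic f -> exists (Z : S) (g : hom Z X), is_cokernel f g
}.

Record functor E D := Functor {
  fobj :> E -> D;
  fmap : forall X Y : E, hom X Y -> hom (fobj X) (fobj Y);
  fmap_id : forall X : E, fmap (idm X) = idm (fobj X);
  fmap_comp : forall (X Y Z : E) (g : hom Y Z) (f : hom X Y),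
    fmap (g \oc f) = fmap g \oc fmap f
}.

Definition exact_functor E D (T : functor E D) : Prop :=
  forall (N M P : E) (i : hom N M) (p : hom M P),
    short_exact i p -> short_exact (fmap T i) (fmap T p).

(* [semisimple] and [maschke] only make sense of kernels, cokernels and splittings
   in E and D themselves, so the abelian structure need not be carried along. *)
Definition semisimple E D (T : functor E D) : Prop :=
  forall (N M P : E) (i : hom N M) (p : hom M P),
    short_exact i p -> split_exact (fmap T i) (fmap T p) -> split_exact i p.

Definition maschke E D (T : functor E D) : Prop :=
  forall (M' M N : E) (i : hom M' M) (f : hom M' N),
    split_mono (fmap T i) -> exists g : hom M N, g \oc i = f.

End LinearCategories.
Arguments postcomp {k S X Y Z} g.
Arguments precomp {k S X Y Z} f.

Section Composition.
Context {k : fieldType} {S : lincat k}.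
Lemma compDl (X Y Z : S) a (g h : hom Y Z) (f : hom X Y) :
  (a *: g + h) \oc f = a *: (g \oc f) + h \oc f.
Proof. exact: comp_linl. Qed.
Lemma compDr (X Y Z : S) a (g : hom Y Z) (f h : hom X Y) :
  g \oc (a *: f + h) = a *: (g \oc f) + g \oc h.
Proof. exact: comp_linr. Qed.
Lemma comp0l (X Y Z : S) (f : hom X Y) : (0 : hom Y Z) \oc f = 0.
Proof. exact: (linear0 (precomp f)). Qed.
Lemma comp0r (X Y Z : S) (g : hom Y Z) : g \oc (0 : hom X Y) = 0.
Proof. exact: (linear0 (postcomp g)). Qed.

Lemma compBl (X Y Z : S) (g h : hom Y Z) (f : hom X Y) : (g - h) \oc f = g \oc f - h \oc f.
Proof. exact: (linearB (precomp f)). Qed.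
Lemma compBr (X Y Z : S) (g : hom Y Z) (f h : hom X Y) : g \oc (f - h) = g \oc f - g \oc h.
Proof. exact: (linearB (postcomp g)). Qed.
Lemma comp_sumr (X Y Z : S) I (r : seq I) (g : hom Y Z) (F : I -> hom X Y) :
  g \oc (\sum_(i <- r) F i) = \sum_(i <- r) (g \oc F i).
Proof. exact: (linear_sum (postcomp g)). Qed.
Lemma comp_suml (X Y Z : S) I (r : seq I) (F : I -> hom Y Z) (f : hom X Y) :
  (\sum_(i <- r) F i) \oc f = \sum_(i <- r) (F i \oc f).
Proof. exact: (linear_sum (precomp f)). Qed.
End Composition.

Record smallcat := SmallCat {
  sc_obj :> Type;
  sc_hom : sc_obj -> sc_obj -> Type;
  sc_id : forall i, sc_hom i i;
  sc_comp : forall i j l, sc_hom j l -> sc_hom i j -> sc_hom i l;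
  sc_assoc : forall i j l m (c : sc_hom l m) (b : sc_hom j l) (a : sc_hom i j),
    sc_comp c (sc_comp b a) = sc_comp (sc_comp c b) a;
  sc_idl : forall i j (a : sc_hom i j), sc_comp (sc_id j) a = a;
  sc_idr : forall i j (a : sc_hom i j), sc_comp a (sc_id i) = a
}.

Record filtered (J : smallcat) : Prop := Filtered {
  filt_inhabited : inhabited J;
  filt_obj : forall i j : J, exists l : J, inhabited (sc_hom i l) /\ inhabited (sc_hom j l);
  filt_hom : forall (i j : J) (a b : sc_hom i j),
    exists (l : J) (c : sc_hom j l), sc_comp c a = sc_comp c b
}.

Section Grothendieck.
Context {k : fieldType}.
Implicit Types S : lincat k.

Record diagram (J : smallcat) S := Diagram {
  dobj :> J -> S;
  dmap : forall i j : J, sc_hom i j -> hom (dobj i) (dobj j);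
  dmap_id : forall i, dmap (sc_id i) = idm (dobj i);
  dmap_comp : forall i j l (b : sc_hom j l) (a : sc_hom i j),
    dmap (sc_comp b a) = dmap b \oc dmap a
}.

Definition natural (J : smallcat) S (F G : diagram J S)
    (t : forall j, hom (F j) (G j)) : Prop :=
  forall (i j : J) (a : sc_hom i j), dmap G a \oc t i = t j \oc dmap F a.

Definition is_cocone (J : smallcat) S (F : diagram J S) (X : S)
    (c : forall j, hom (F j) X) : Prop :=
  forall (i j : J) (a : sc_hom i j), c j \oc dmap F a = c i.

Definition is_colimit (J : smallcat) S (F : diagram J S) (X : S)
    (c : forall j, hom (F j) X) : Prop :=
  is_cocone c /\
  forall (Y : S) (d : forall j, hom (F j) Y), is_cocone d ->
    exists! h : hom X Y, forall j, h \oc c j = d j.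

Definition is_coproduct (I : Type) S (F : I -> S) (X : S)
    (c : forall i, hom (F i) X) : Prop :=
  forall (Y : S) (d : forall i, hom (F i) Y),
    exists! h : hom X Y, forall i, h \oc c i = d i.

Definition has_coproducts S : Prop :=
  forall (I : Type) (F : I -> S), exists (X : S) (c : forall i, hom (F i) X), is_coproduct c.

Definition filtered_colimits_exact S : Prop :=
  forall (J : smallcat) (F G H : diagram J S)
    (t : forall j, hom (F j) (G j)) (u : forall j, hom (G j) (H j))
    (X Y Z : S) (c : forall j, hom (F j) X) (d : forall j, hom (G j) Y)
    (e : forall j, hom (H j) Z) (a : hom X Y) (b : hom Y Z),
  filtered J -> natural t -> natural u -> (forall j, short_exact (t j) (u j)) ->
  is_colimit c -> is_colimit d -> is_colimit e ->
  (forall j, a \oc c j = d j \oc t j) -> (forall j, b \oc d j = e j \oc u j) ->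
  short_exact a b.

Definition generator S (G : S) : Prop :=
  forall (X Y : S) (f : hom X Y), (forall g : hom G X, f \oc g = 0) -> f = 0.

Record grothendieck S : Prop := Grothendieck {
  gr_abelian : abelian S;
  gr_coproducts : has_coproducts S;
  gr_filtered : filtered_colimits_exact S;
  gr_generator : exists G : S, generator G
}.
End Grothendieck.

(* [ten M V] is M (x) V, the value at V of the left adjoint of S(M, -), given by
   the unit V -> S(M, M (x) V) and its universal property. *)
Record tensoring (k : fieldType) (S : lincat k) := Tensoring {
  ten : S -> lmodType k -> S;
  ten_in : forall (M : S) (V : lmodType k), {linear V -> hom M (ten M V)};
  ten_lift : forall (M : S) (V : lmodType k) (N : S), {linear V -> hom M N} -> hom (ten M V) N;
  ten_liftK : forall (M : S) (V : lmodType k) (N : S) (f : {linear V -> hom M N}) v,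
    ten_lift f \oc ten_in M V v = f v;
  ten_ext : forall (M : S) (V : lmodType k) (N : S) (g h : hom (ten M V) N),
    (forall v, g \oc ten_in M V v = h \oc ten_in M V v) -> g = h
}.

Section Tensoring.
Context {k : fieldType} {S : lincat k} (tS : tensoring S).
Implicit Types (M N P X : S) (V W : lmodType k).
Local Notation ten := (ten tS).
Local Notation ten_in := (ten_in tS).
Local Notation ten_lift := (ten_lift tS).

Lemma ten_lift_lin M V N a (f g h : {linear V -> hom M N}) :
  (forall v, f v = a *: g v + h v) -> ten_lift f = a *: ten_lift g + ten_lift h.
Proof. by move=> e; apply: ten_ext => v; rewrite compDl !ten_liftK. Qed.

Definition ten_map M N V W (g : hom M N) (f : {linear V -> W}) : hom (ten M V) (ten N W) :=
  ten_lift (precomp g \o (ten_in N W \o f)).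

Lemma ten_mapE M N V W (g : hom M N) (f : {linear V -> W}) v :
  ten_map g f \oc ten_in M V v = ten_in N W (f v) \oc g.
Proof. exact: ten_liftK. Qed.

Lemma ten_map_id M V : ten_map (idm M) (linid V) = idm (ten M V).
Proof. by apply: ten_ext => v; rewrite ten_mapE comp_idl comp_idr. Qed.

Lemma ten_map_compl M N P V (g : hom N P) (f : hom M N) :
  ten_map (g \oc f) (linid V) = ten_map g (linid V) \oc ten_map f (linid V).
Proof.
apply: ten_ext => v.
by rewrite ten_mapE -[RHS]comp_assoc ten_mapE [RHS]comp_assoc ten_mapE -[RHS]comp_assoc.
Qed.

Lemma ten_map_lin M N V W a (g h : hom M N) (f : {linear V -> W}) :
  ten_map (a *: g + h) f = a *: ten_map g f + ten_map h f.
Proof. by apply: ten_ext => v; rewrite compDl !ten_mapE compDr. Qed.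

(* The canonical isomorphism (M (x) V) (x) W -> M (x) (V (x) W) and its inverse. *)
Fact ten_assoc_linear1 M V W (w : W) : linear (fun v : V => ten_in M (V \ox W) (tpure v w)).
Proof. by move=> a x y; rewrite tpureDl linearP. Qed.
Definition ten_assoc1 M V W (w : W) : {linear V -> hom M (ten M (V \ox W))} :=
  HB.pack (fun v : V => ten_in M (V \ox W) (tpure v w))
    (GRing.isLinear.Build k V (hom M (ten M (V \ox W))) *:%R _ (@ten_assoc_linear1 M V W w)).
Fact ten_assoc_linear M V W : linear (fun w : W => ten_lift (ten_assoc1 M V w)).
Proof. by move=> a x y; apply: ten_lift_lin => v /=; rewrite tpureDr linearP. Qed.
Definition ten_assoc M V W : hom (ten (ten M V) W) (ten M (V \ox W)) :=
  ten_lift (HB.pack (fun w : W => ten_lift (ten_assoc1 M V w))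
    (GRing.isLinear.Build k W (hom (ten M V) (ten M (V \ox W))) *:%R _
      (@ten_assoc_linear M V W))).

Fact ten_assocV_bilin M V W :
  bilin (fun (v : V) (w : W) => ten_in (ten M V) W w \oc ten_in M V v).
Proof. by split=> [w|v] a x y; rewrite linearP (compDl, compDr). Qed.
Definition ten_assocV M V W : hom (ten M (V \ox W)) (ten (ten M V) W) :=
  ten_lift (tlift (@ten_assocV_bilin M V W)).

Lemma ten_assocE M V W v w :
  ten_assoc M V W \oc ten_in (ten M V) W w \oc ten_in M V v = ten_in M (V \ox W) (tpure v w).
Proof. by rewrite !ten_liftK. Qed.

Lemma ten_assocVE M V W v w :
  ten_assocV M V W \oc ten_in M (V \ox W) (tpure v w) =
  ten_in (ten M V) W w \oc ten_in M V v.
Proof. by rewrite ten_liftK tlift_pure. Qed.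

Lemma ten_assocK M V W : ten_assocV M V W \oc ten_assoc M V W = idm _.
Proof.
apply: ten_ext => w; apply: ten_ext => v.
by rewrite -!comp_assoc [_ \oc (_ \oc _ v)]comp_assoc ten_assocE ten_assocVE comp_idl.
Qed.

Lemma ten_assocVK M V W : ten_assoc M V W \oc ten_assocV M V W = idm _.
Proof.
apply: ten_ext => x; rewrite (tens_spanned x) linear_sum !comp_sumr.
apply: eq_bigr => p _ /=.
by rewrite -comp_assoc ten_assocVE comp_assoc ten_assocE comp_idl.
Qed.

(* The canonical isomorphism M (x) k -> M and its inverse. *)
Fact scale_id_linear M : linear (fun r : k^o => (r : k) *: idm M).
Proof. by move=> a r s; rewrite scalerDl scalerA. Qed.
Definition scale_id M : {linear k^o -> hom M M} :=
  HB.pack (fun r : k^o => (r : k) *: idm M)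
    (GRing.isLinear.Build k k^o (hom M M) *:%R _ (@scale_id_linear M)).
Definition ten_unit M : hom (ten M k^o) M := ten_lift (scale_id M).
Definition ten_unitV M : hom M (ten M k^o) := ten_in M k^o 1.

(* [cot V M] is (V, M), the value at M of the right adjoint of V (x) -, given by
   the counit V (x) (V, M) -> M and its universal property. *)
Record cotensoring := Cotensoring {
  cot : lmodType k -> S -> S;
  cot_ev : forall (V : lmodType k) (M : S), hom (ten (cot V M) V) M;
  cot_cur : forall (V : lmodType k) (M X : S), hom (ten X V) M -> hom X (cot V M);
  cot_curK : forall (V : lmodType k) (M X : S) (f : hom (ten X V) M),
    cot_ev V M \oc ten_map (cot_cur f) (linid V) = f;
  cot_uniq : forall (V : lmodType k) (M X : S) (g h : hom X (cot V M)),
    cot_ev V M \oc ten_map g (linid V) = cot_ev V M \oc ten_map h (linid V) -> g = h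
}.

Section Cotensoring.
Variable cS : cotensoring.
Local Notation cot := (cot cS).

(* Evaluation at v of (V, M), and the map X -> (V, M) with given evaluations. *)
Definition cot_at V M : {linear V -> hom (cot V M) M} :=
  postcomp (cot_ev cS V M) \o ten_in (cot V M) V.
Definition cot_lift X V M (f : {linear V -> hom X M}) : hom X (cot V M) :=
  cot_cur cS (ten_lift f).

Lemma cot_liftK X V M (f : {linear V -> hom X M}) v : cot_at V M v \oc cot_lift f = f v.
Proof.
by rewrite /= -comp_assoc -[ten_in _ _ v]/(ten_in _ _ (linid V v)) -ten_mapE comp_assoc
  cot_curK ten_liftK.
Qed.

Lemma cot_ext X V M (g h : hom X (cot V M)) :
  (forall v, cot_at V M v \oc g = cot_at V M v \oc h) -> g = h.
Proof.
move=> e; apply: cot_uniq; apply: ten_ext => v; have := e v.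
by rewrite /= -!comp_assoc !ten_mapE.
Qed.

Lemma cot_lift_lin X V M a (f g h : {linear V -> hom X M}) :
  (forall v, f v = a *: g v + h v) -> cot_lift f = a *: cot_lift g + cot_lift h.
Proof. by move=> e; apply: cot_ext => v; rewrite compDr !cot_liftK. Qed.

Definition cot_map V W M N (f : {linear V -> W}) (g : hom M N) : hom (cot W M) (cot V N) :=
  cot_cur cS (g \oc cot_ev cS W M \oc ten_map (idm (cot W M)) f).

Lemma cot_mapE V W M N (f : {linear V -> W}) (g : hom M N) v :
  cot_at V N v \oc cot_map f g = g \oc cot_at W M (f v).
Proof.
rewrite /= -comp_assoc -[ten_in _ _ v]/(ten_in _ _ (linid V v)) -ten_mapE comp_assoc cot_curK.
by rewrite -comp_assoc ten_mapE comp_idr comp_assoc.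
Qed.

Lemma cot_map_id V M : cot_map (linid V) (idm M) = idm (cot V M).
Proof. by apply: cot_ext => v; rewrite cot_mapE comp_idl comp_idr. Qed.

Lemma cot_map_comp (U V W : lmodType k) M N P (f : {linear U -> V}) (f' : {linear V -> W})
    (g : hom M N) (g' : hom N P) :
  cot_map (f' \o f) (g' \oc g) = cot_map f g' \oc cot_map f' g.
Proof.
apply: cot_ext => u; rewrite cot_mapE comp_assoc cot_mapE.
by rewrite -[RHS]comp_assoc cot_mapE comp_assoc.
Qed.

Lemma cot_map_lin V W M N (f : {linear V -> W}) a (g h : hom M N) :
  cot_map f (a *: g + h) = a *: cot_map f g + cot_map f h.
Proof. by apply: cot_ext => v; rewrite compDr !cot_mapE compDl. Qed.

Lemma cot_map_compr V M N P (g : hom N P) (f : hom M N) :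
  cot_map (linid V) (g \oc f) = cot_map (linid V) g \oc cot_map (linid V) f.
Proof.
apply: cot_ext => v; rewrite cot_mapE comp_assoc cot_mapE.
by rewrite -[RHS]comp_assoc cot_mapE comp_assoc.
Qed.

Definition cot_functor V : functor S S :=
  Functor (fobj := cot V) (fmap := fun M N => cot_map (linid V)) (cot_map_id V)
    (@cot_map_compr V).

(* The canonical isomorphism (V, (W, M)) -> (W (x) V, M) and its inverse. *)
Fact cot_assoc_bilin V W M :
  bilin (fun (w : W) (v : V) => cot_at W M w \oc cot_at V (cot W M) v).
Proof. by split=> [v|w] a x y; rewrite linearP (compDl, compDr). Qed.
Definition cot_assoc V W M : hom (cot V (cot W M)) (cot (W \ox V) M) :=
  cot_lift (tlift (@cot_assoc_bilin V W M)).

Fact cot_assocV_linear1 V W M (v : V) : linear (fun w : W => cot_at (W \ox V) M (tpure w v)).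
Proof. by move=> a x y; rewrite tpureDl linearP. Qed.
Definition cot_assocV1 V W M (v : V) : {linear W -> hom (cot (W \ox V) M) M} :=
  HB.pack (fun w : W => cot_at (W \ox V) M (tpure w v))
    (GRing.isLinear.Build k W (hom (cot (W \ox V) M) M) *:%R _ (@cot_assocV_linear1 V W M v)).
Fact cot_assocV_linear V W M : linear (fun v : V => cot_lift (cot_assocV1 W M v)).
Proof. by move=> a x y; apply: cot_lift_lin => w /=; rewrite tpureDr linearP compDr. Qed.
Definition cot_assocV V W M : hom (cot (W \ox V) M) (cot V (cot W M)) :=
  cot_lift (HB.pack (fun v : V => cot_lift (cot_assocV1 W M v))
    (GRing.isLinear.Build k V (hom (cot (W \ox V) M) (cot W M)) *:%R _
      (@cot_assocV_linear V W M))).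

Lemma cot_assocE V W M w v :
  cot_at (W \ox V) M (tpure w v) \oc cot_assoc V W M =
  cot_at W M w \oc cot_at V (cot W M) v.
Proof. by rewrite cot_liftK tlift_pure. Qed.

Lemma cot_assocVE V W M w v :
  cot_at W M w \oc (cot_at V (cot W M) v \oc cot_assocV V W M) =
  cot_at (W \ox V) M (tpure w v).
Proof. by rewrite !cot_liftK. Qed.

Lemma cot_assocK V W M : cot_assocV V W M \oc cot_assoc V W M = idm _.
Proof.
apply: cot_ext => v; apply: cot_ext => w; rewrite comp_idr -cot_assocE -cot_assocVE.
by rewrite -[RHS]comp_assoc -[X in _ = _ \oc X]comp_assoc.
Qed.

Lemma cot_assocVK V W M : cot_assoc V W M \oc cot_assocV V W M = idm _.
Proof.
apply: cot_ext => x; rewrite (tens_spanned x) linear_sum !comp_suml.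
apply: eq_bigr => p _ /=.
by rewrite comp_idr comp_assoc (cot_assocE M) -[LHS]comp_assoc cot_assocVE.
Qed.

(* The canonical isomorphism M -> (k, M). *)
Definition cot_unit M : hom M (cot k^o M) := cot_lift (scale_id M).

End Cotensoring.
End Tensoring.

Definition subspace_axiom (k : fieldType) (V : lmodType k) (P : V -> Prop) : Prop :=
  P 0 /\ forall a x y, P x -> P y -> P (a *: x + y).

Section Subspace.
Variables (k : fieldType) (V : lmodType k) (P : V -> Prop) (hP : subspace_axiom P).
Definition subspace_pred : {pred V} := fun x => `[< P x >].
Definition subspace (_ : subspace_axiom P) : Type := {x : V | x \in subspace_pred}.
Local Notation sub := (subspace hP).
HB.instance Definition _ := SubType.on sub.
HB.instance Definition _ := [Choice of sub by <:].
Fact subspace_pred_closed : submod_closed subspace_pred.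
Proof.
split; first by apply/asboolP; exact: hP.1.
by move=> a x y /asboolP hx /asboolP hy; apply/asboolP; exact: hP.2.
Qed.
HB.instance Definition _ :=
  GRing.SubChoice_isSubLmodule.Build k V subspace_pred sub subspace_pred_closed.
End Subspace.

Section Structured.
Context {k : fieldType} (S : lincat k).

(* A class T of objects of S with structure, together with the morphisms of S
   that preserve it. *)
Record structure := Structure {
  st_obj : Type;
  st_car : st_obj -> S;
  st_hom : forall X Y : st_obj, hom (st_car X) (st_car Y) -> Prop;
  st_sub : forall X Y : st_obj, subspace_axiom (@st_hom X Y);
  st_id : forall X : st_obj, st_hom (idm (st_car X));
  st_comp : forall (X Y Z : st_obj) (g : hom (st_car Y) (st_car Z))
    (f : hom (st_car X) (st_car Y)), st_hom g -> st_hom f -> st_hom (g \oc f)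
}.

Section Category.
Variable T : structure.
Definition st_homs (X Y : st_obj T) : lmodType k := subspace (st_sub X Y).
Definition st_val (X Y : st_obj T) (f : st_homs X Y) : hom (st_car X) (st_car Y) := val f.

Lemma st_valP X Y (f : st_homs X Y) : st_hom (st_val f).
Proof. exact/asboolP/(valP f). Qed.

Definition st_mk X Y (f : hom (st_car X) (st_car Y)) (hf : st_hom f) : st_homs X Y :=
  Sub f (asboolT hf).

Lemma st_mkK X Y f hf : st_val (@st_mk X Y f hf) = f.
Proof. exact: SubK. Qed.
Lemma st_val_inj X Y : injective (@st_val X Y).
Proof. exact: val_inj. Qed.
Lemma st_val_lin X Y a (f g : st_homs X Y) : st_val (a *: f + g) = a *: st_val f + st_val g.
Proof. by rewrite /st_val linearP. Qed.

Definition st_comps X Y Z (g : st_homs Y Z) (f : st_homs X Y) : st_homs X Z :=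
  st_mk (st_comp (st_valP g) (st_valP f)).

Fact st_assoc X Y Z W (h : st_homs Z W) (g : st_homs Y Z) (f : st_homs X Y) :
  st_comps h (st_comps g f) = st_comps (st_comps h g) f.
Proof. by apply: st_val_inj; rewrite !st_mkK comp_assoc. Qed.
Fact st_idl X Y (f : st_homs X Y) : st_comps (st_mk (st_id Y)) f = f.
Proof. by apply: st_val_inj; rewrite !st_mkK comp_idl. Qed.
Fact st_idr X Y (f : st_homs X Y) : st_comps f (st_mk (st_id X)) = f.
Proof. by apply: st_val_inj; rewrite !st_mkK comp_idr. Qed.
Fact st_linl X Y Z (f : st_homs X Y) : linear (fun g : st_homs Y Z => st_comps g f).
Proof. by move=> a g h; apply: st_val_inj; rewrite st_val_lin !st_mkK st_val_lin compDl. Qed.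
Fact st_linr X Y Z (g : st_homs Y Z) : linear (fun f : st_homs X Y => st_comps g f).
Proof. by move=> a f h; apply: st_val_inj; rewrite st_val_lin !st_mkK st_val_lin compDr. Qed.

Definition st_cat : lincat k :=
  @LinCat k (st_obj T) st_homs (fun X => st_mk (st_id X)) st_comps st_assoc st_idl st_idr st_linl st_linr.
End Category.

Section Forget.
Variable T : structure.
Record extra_structure := ExtraStructure {
  ex_obj : Type;
  ex_base : ex_obj -> st_obj T;
  ex_hom : forall X Y : ex_obj, hom (st_car (ex_base X)) (st_car (ex_base Y)) -> Prop;
  ex_sub : forall X Y : ex_obj, subspace_axiom (@ex_hom X Y);
  ex_id : forall X : ex_obj, ex_hom (idm (st_car (ex_base X)));
  ex_comp : forall (X Y Z : ex_obj) (g : hom (st_car (ex_base Y)) (st_car (ex_base Z)))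
    (f : hom (st_car (ex_base X)) (st_car (ex_base Y))), ex_hom g -> ex_hom f -> ex_hom (g \oc f)
}.
Variable Q : extra_structure.

Definition ext_hom (X Y : ex_obj Q) (f : hom (st_car (ex_base X)) (st_car (ex_base Y))) : Prop :=
  st_hom f /\ ex_hom f.
Fact ext_sub X Y : subspace_axiom (@ext_hom X Y).
Proof.
split; first by split; [exact: (st_sub _ _).1 | exact: (ex_sub _ _).1].
by move=> a f g [f1 f2] [g1 g2]; split; [exact: (st_sub _ _).2 | exact: (ex_sub _ _).2].
Qed.
Fact ext_id (X : ex_obj Q) : ext_hom (idm (st_car (ex_base X))).
Proof. by split; [exact: st_id | exact: ex_id]. Qed.
Fact ext_comp (X Y Z : ex_obj Q) (g : hom (st_car (ex_base Y)) (st_car (ex_base Z)))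
  (f : hom (st_car (ex_base X)) (st_car (ex_base Y))) :
  ext_hom g -> ext_hom f -> ext_hom (g \oc f).
Proof. by move=> [g1 g2] [f1 f2]; split; [exact: st_comp | exact: ex_comp]. Qed.
Definition extended : structure := Structure ext_sub ext_id ext_comp.

Definition forget_map (X Y : st_cat extended) (f : hom X Y) :
    @hom k (st_cat T) (ex_base X) (ex_base Y) :=
  st_mk (st_valP f).1.
Fact forget_id (X : st_cat extended) :
  forget_map (idm X) = @idm k (st_cat T) (ex_base X).
Proof. by apply: st_val_inj; rewrite !st_mkK. Qed.
Fact forget_comp (X Y Z : st_cat extended) (g : hom Y Z) (f : hom X Y) :
  forget_map (g \oc f) = forget_map g \oc forget_map f.
Proof. by apply: st_val_inj; rewrite !st_mkK. Qed.
Definition forget : functor (st_cat extended) (st_cat T) :=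
  @Functor k (st_cat extended) (st_cat T) (@ex_base Q) forget_map forget_id forget_comp.
End Forget.
End Structured.

Section EntwinedModules.
Context {k : fieldType} {S : lincat k} (tS : tensoring S).
Variables (A C : lmodType k) (a : algebra_on A) (c : coalgebra_on C) (psi : entwining a c).

Section Contramodules.
Variable cS : cotensoring tS.
Local Notation cot := (cot cS).
Local Notation cotl f M := (cot_map cS f (idm M)).
Local Notation cotr V g := (cot_map cS (linid V) g).

Record contramodule := Contramodule {
  cm_car : S;
  cm_pi : hom (cot C cm_car) cm_car;
  cm_counit : cm_pi \oc cotl (ceps c) cm_car \oc cot_unit cS cm_car = idm cm_car;
  cm_assoc : cm_pi \oc cotl (cmul c) cm_car \oc cot_assoc cS C C cm_car =
             cm_pi \oc cotr C cm_pi
}.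

Definition contra_hom (X Y : contramodule) (f : hom (cm_car X) (cm_car Y)) : Prop :=
  f \oc cm_pi X = cm_pi Y \oc cotr C f.

Fact contra_sub X Y : subspace_axiom (@contra_hom X Y).
Proof.
split.
  have e := cot_map_lin cS (linid C) (-1) (0 : hom (cm_car X) (cm_car Y)) 0.
  rewrite scaler0 addr0 scaleN1r addNr in e.
  by rewrite /contra_hom e comp0l comp0r.
by move=> r f g hf hg; rewrite /contra_hom compDl hf hg cot_map_lin compDr.
Qed.
Fact contra_id X : @contra_hom X X (idm (cm_car X)).
Proof. by rewrite /contra_hom cot_map_id comp_idl comp_idr. Qed.
Fact contra_comp X Y Z g f : @contra_hom Y Z g -> @contra_hom X Y f -> contra_hom (g \oc f).
Proof.
move=> hg hf; rewrite /contra_hom cot_map_compr.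
by rewrite -[LHS]comp_assoc hf comp_assoc hg comp_assoc.
Qed.

Definition contra_structure : structure S := Structure contra_sub contra_id contra_comp.
Definition contra_cat : lincat k := st_cat contra_structure.

Record entwined_contramodule := EntwinedContramodule {
  ec_contra : contramodule;
  ec_mu : hom (cm_car ec_contra) (cot A (cm_car ec_contra));
  ec_assoc : cotl (amul a) (cm_car ec_contra) \oc ec_mu =
             cot_assoc cS A A (cm_car ec_contra) \oc cotr A ec_mu \oc ec_mu;
  ec_unit : cotl (aone a) (cm_car ec_contra) \oc ec_mu = cot_unit cS (cm_car ec_contra);
  ec_entwined :
    ec_mu \oc cm_pi ec_contra =
    cotr A (cm_pi ec_contra) \oc cot_assocV cS A C (cm_car ec_contra)
      \oc cotl psi (cm_car ec_contra) \oc cot_assoc cS C A (cm_car ec_contra)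
      \oc cotr C ec_mu
}.

Definition ec_hom (X Y : entwined_contramodule)
    (f : hom (cm_car (ec_contra X)) (cm_car (ec_contra Y))) : Prop :=
  cotr A f \oc ec_mu X = ec_mu Y \oc f.

Fact ec_sub X Y : subspace_axiom (@ec_hom X Y).
Proof.
split.
  have e := cot_map_lin cS (linid A) (-1)
    (0 : hom (cm_car (ec_contra X)) (cm_car (ec_contra Y))) 0.
  rewrite scaler0 addr0 scaleN1r addNr in e.
  by rewrite /ec_hom e comp0l comp0r.
by move=> r f g hf hg; rewrite /ec_hom compDr -hf -hg cot_map_lin compDl.
Qed.
Fact ec_id X : @ec_hom X X (idm (cm_car (ec_contra X))).
Proof. by rewrite /ec_hom cot_map_id comp_idl comp_idr. Qed.
Fact ec_comp X Y Z g f : @ec_hom Y Z g -> @ec_hom X Y f -> ec_hom (g \oc f).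
Proof.
move=> hg hf; rewrite /ec_hom cot_map_compr.
by rewrite -[LHS]comp_assoc hf comp_assoc hg comp_assoc.
Qed.

Definition ec_structure : extra_structure contra_structure :=
  @ExtraStructure k S contra_structure entwined_contramodule ec_contra ec_hom
    ec_sub ec_id ec_comp.
Definition entwined_contra_cat : lincat k := st_cat (extended ec_structure).
Definition contra_forget : functor entwined_contra_cat contra_cat := forget ec_structure.
End Contramodules.

Section Comodules.
Local Notation ten := (ten tS).
Local Notation tenl g V := (ten_map tS g (linid V)).
Local Notation tenr M f := (ten_map tS (idm M) f).

Record comodule := Comodule {
  co_car : S;
  co_delta : hom co_car (ten co_car C);
  co_counit : ten_unit tS co_car \oc tenr co_car (ceps c) \oc co_delta = idm co_car;
  co_assoc : ten_assoc tS co_car C C \oc tenl co_delta C \oc co_delta =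
             tenr co_car (cmul c) \oc co_delta
}.

Definition comod_hom (X Y : comodule) (f : hom (co_car X) (co_car Y)) : Prop :=
  co_delta Y \oc f = tenl f C \oc co_delta X.

Fact comod_sub X Y : subspace_axiom (@comod_hom X Y).
Proof.
split.
  have e := ten_map_lin tS (-1) (0 : hom (co_car X) (co_car Y)) 0 (linid C).
  rewrite scaler0 addr0 scaleN1r addNr in e.
  by rewrite /comod_hom e comp0l comp0r.
by move=> r f g hf hg; rewrite /comod_hom compDr hf hg ten_map_lin compDl.
Qed.
Fact comod_id X : @comod_hom X X (idm (co_car X)).
Proof. by rewrite /comod_hom ten_map_id comp_idl comp_idr. Qed.
Fact comod_comp X Y Z g f : @comod_hom Y Z g -> @comod_hom X Y f -> comod_hom (g \oc f).
Proof.
move=> hg hf; rewrite /comod_hom ten_map_compl.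
by rewrite comp_assoc hg -[LHS]comp_assoc hf comp_assoc.
Qed.

Definition comod_structure : structure S := Structure comod_sub comod_id comod_comp.
Definition comod_cat : lincat k := st_cat comod_structure.

Record entwined_module := EntwinedModule {
  em_comod : comodule;
  em_mu : hom (ten (co_car em_comod) A) (co_car em_comod);
  em_assoc : em_mu \oc tenl em_mu A =
             em_mu \oc tenr (co_car em_comod) (amul a) \oc ten_assoc tS (co_car em_comod) A A;
  em_unit : em_mu \oc tenr (co_car em_comod) (aone a) \oc ten_unitV tS (co_car em_comod) =
            idm (co_car em_comod);
  em_entwined :
    co_delta em_comod \oc em_mu =
    tenl em_mu C \oc ten_assocV tS (co_car em_comod) A C
      \oc tenr (co_car em_comod) psi \oc ten_assoc tS (co_car em_comod) C A
      \oc tenl (co_delta em_comod) A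
}.

Definition em_hom (X Y : entwined_module)
    (f : hom (co_car (em_comod X)) (co_car (em_comod Y))) : Prop :=
  f \oc em_mu X = em_mu Y \oc tenl f A.

Fact em_sub X Y : subspace_axiom (@em_hom X Y).
Proof.
split.
  have e := ten_map_lin tS (-1)
    (0 : hom (co_car (em_comod X)) (co_car (em_comod Y))) 0 (linid A).
  rewrite scaler0 addr0 scaleN1r addNr in e.
  by rewrite /em_hom e comp0l comp0r.
by move=> r f g hf hg; rewrite /em_hom compDl hf hg ten_map_lin compDr.
Qed.
Fact em_id X : @em_hom X X (idm (co_car (em_comod X))).
Proof. by rewrite /em_hom ten_map_id comp_idl comp_idr. Qed.
Fact em_comp X Y Z g f : @em_hom Y Z g -> @em_hom X Y f -> em_hom (g \oc f).
Proof.
move=> hg hf; rewrite /em_hom ten_map_compl.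
by rewrite -[LHS]comp_assoc hf comp_assoc hg comp_assoc.
Qed.

Definition em_structure : extra_structure comod_structure :=
  @ExtraStructure k S comod_structure entwined_module em_comod em_hom em_sub em_id em_comp.
Definition entwined_module_cat : lincat k := st_cat (extended em_structure).
Definition comod_forget : functor entwined_module_cat comod_cat := forget em_structure.
End Comodules.
End EntwinedModules.

(* [tensoring] and [cotensoring] are chosen adjoints, hence data; the lemmas below
   show that every Grothendieck category has them, so that taking them as
   arguments assumes nothing. *)
Section Existence.
Context {k : fieldType} {S : lincat k} (gS : grothendieck S).

Lemma coprod_ext (I : Type) (F : I -> S) (X : S) (c : forall i, hom (F i) X) (Y : S)
    (g h : hom X Y) : is_coproduct c -> (forall i, g \oc c i = h \oc c i) -> g = h.
Proof.
move=> hc e; have [m [_ um]] := hc Y (fun i => g \oc c i).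
by rewrite -(um g) // (um h).
Qed.

Lemma coker_epic (X Y Q : S) (p : hom Y Q) (f : hom X Y) : is_cokernel p f -> epic p.
Proof.
move=> [pf u] T g h e; have [|m [_ um]] := u T (g \oc p).
  by rewrite -comp_assoc pf comp0r.
by rewrite -(um g) // (um h).
Qed.

Lemma epic_coker_ker (X Y K : S) (p : hom X Y) (i : hom K X) :
  epic p -> is_kernel i p -> is_cokernel p i.
Proof.
move=> ep [pi ui]; split=> // T g gi.
have [Z [f [pf uf]]] := ab_epi (gr_abelian gS) ep.
have [h [hi _]] := ui _ f pf.
have gf : g \oc f = 0 by rewrite -hi comp_assoc gi comp0l.
by have := uf _ g gf.
Qed.

Lemma ten_exists (M : S) (V : lmodType k) :
  exists (Q : S) (i : {linear V -> hom M Q}),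
    forall (N : S) (f : {linear V -> hom M N}), exists! g : hom Q N, forall v, g \oc i v = f v.
Proof.
have [X [c hc]] := gr_coproducts gS (fun _ : V => M).
have [R [d hd]] := gr_coproducts gS (fun _ : k * V * V => M).
have [rel [hrel _]] := hd X (fun t => c (t.1.1 *: t.1.2 + t.2) - (t.1.1 *: c t.1.2 + c t.2)).
have [Q [q hq]] := ab_coker (gr_abelian gS) rel.
have lin : linear (fun v : V => q \oc c v).
  move=> a v w; apply/eqP; rewrite -compDr -subr_eq0 -compBr.
  by rewrite -(hrel (a, v, w)) comp_assoc hq.1 comp0l.
pose i : {linear V -> hom M Q} := HB.pack (fun v : V => q \oc c v)
  (GRing.isLinear.Build k V (hom M Q) *:%R _ lin).
exists Q, i => N f /=.
have [h [hh _]] := hc N f.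
have hr : h \oc rel = 0.
  apply: (coprod_ext hd) => t; rewrite -comp_assoc hrel comp0l.
  by rewrite compBr compDr !hh linearP subrr.
have [g [gq _]] := hq.2 _ h hr.
exists g; split=> [v|g' e]; first by rewrite comp_assoc gq hh.
apply: (coker_epic hq); apply: (coprod_ext hc) => v.
by rewrite gq hh -e comp_assoc.
Qed.

Lemma tensoring_exists : inhabited (tensoring S).
Proof.
have ex : forall MV : S * lmodType k,
    exists Q : {Q : S & {linear MV.2 -> hom MV.1 Q}},
      forall (N : S) (f : {linear MV.2 -> hom MV.1 N}),
        exists! g : hom (projT1 Q) N, forall v, g \oc projT2 Q v = f v.
  by move=> [M V]; have [Q [i h]] := ten_exists M V; exists (existT _ Q i).
pose T x := projT1 (cid (ex x)).
have hT (x : S * lmodType k) (N : S) (f : {linear x.2 -> hom x.1 N}) :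
    exists! g : hom (projT1 (T x)) N, forall v, g \oc projT2 (T x) v = f v.
  exact: (projT2 (cid (ex x))).
pose lift (M : S) (V : lmodType k) (N : S) (f : {linear V -> hom M N}) := projT1 (cid (hT (M, V) N f)).
have liftK (M : S) (V : lmodType k) (N : S) (f : {linear V -> hom M N}) v : lift M V N f \oc projT2 (T (M, V)) v = f v.
  by rewrite /lift; case: cid => g [].
constructor; apply: (@Tensoring k S (fun M V => projT1 (T (M, V)))
  (fun M V => projT2 (T (M, V))) lift liftK).
move=> M V N g h e.
have [m [_ um]] := hT (M, V) N (postcomp g \o projT2 (T (M, V)) : {linear V -> hom M N}).
by rewrite -(um g) // (um h) // => v; rewrite /= e.
Qed.

Lemma cot_exists (M : S) (V : lmodType k) :
  exists (Q : S) (e : {linear V -> hom Q M}),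
    forall (X : S) (x : {linear V -> hom X M}), exists! h : hom X Q, forall v, e v \oc h = x v.
Proof.
have [G hG] := gr_generator gS; have aS := gr_abelian gS.
have [H [c hc]] := gr_coproducts gS (fun _ : {linear V -> hom G M} => G).
have [fH fHE] := choice (fun v : V => hc M (fun s => s v)).
have {}fHE v s : fH v \oc c s = s v by have [] := fHE v.
pose T := {g : hom G H | forall v, fH v \oc g = 0}.
have [P0 [d hd]] := gr_coproducts gS (fun _ : T => G).
have [m0 [m0E _]] := hd H (@proj1_sig _ _).
have [Q [q hq]] := ab_coker aS m0.
have hfH v : fH v \oc m0 = 0.
  by apply: (coprod_ext hd) => t; rewrite -comp_assoc m0E comp0l (proj2_sig t).
have [fQ fQE] := choice (fun v : V => hq.2 M (fH v) (hfH v)).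
have {}fQE v : fQ v \oc q = fH v by have [] := fQE v.
have lin : linear fQ.
  move=> a v w; apply: (coker_epic hq); rewrite compDl !fQE.
  by apply: (coprod_ext hc) => s; rewrite compDl !fHE linearP.
pose e : {linear V -> hom Q M} := HB.pack fQ (GRing.isLinear.Build k V (hom Q M) *:%R _ lin).
have qT (g : hom G H) : (forall v, fH v \oc g = 0) -> q \oc g = 0.
  by move=> hg; rewrite -[g](m0E (exist _ g hg)) comp_assoc hq.1 comp0l.
exists Q, e => X x /=.
suff uniq (y : hom X Q) : (forall v, fQ v \oc y = 0) -> y = 0.
  have [P [t ht]] := gr_coproducts gS (fun _ : hom G X => G).
  have [p [pE _]] := ht X (fun g => g).
  have ep : epic p.
    move=> Z g h egh; apply/eqP; rewrite -subr_eq0; apply/eqP; apply: hG => s.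
    by rewrite -(pE s) comp_assoc compBl egh subrr comp0l.
  have [R [r hr]] := ab_ker aS p.
  have [m [mE _]] := ht H (fun g => c (precomp g \o x)).
  have fm v : fH v \oc m = x v \oc p.
    by apply: (coprod_ext ht) => g; rewrite -!comp_assoc mE fHE pE.
  have qmr : q \oc m \oc r = 0.
    apply: hG => g; rewrite -[LHS]comp_assoc -[LHS]comp_assoc; apply: qT => v.
    by rewrite comp_assoc fm -[LHS]comp_assoc [p \oc _]comp_assoc hr.1 comp0l comp0r.
  have [h [hE _]] := (epic_coker_ker ep hr).2 _ _ qmr.
  have he v : fQ v \oc h = x v.
    by apply: ep; rewrite -comp_assoc hE comp_assoc fQE fm.
  exists h; split=> // h' hh'; apply/eqP; rewrite -subr_eq0; apply/eqP; apply: uniq => v.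
  by rewrite compBr he hh' subrr.
move=> hy.
have [B [i [j [p1 [p2 [p1i p2j p2i p1j ijB]]]]]] := ab_biprod aS X H.
pose w : hom B Q := y \oc p1 - q \oc p2.
have wi : w \oc i = y by rewrite compBl -!comp_assoc p1i p2i comp0r comp_idr subr0.
have wj : w \oc j = - q by rewrite compBl -!comp_assoc p1j p2j comp0r comp_idr sub0r.
have ew : epic w.
  move=> Z g h egh; apply: (coker_epic hq).
  have : g \oc w \oc j = h \oc w \oc j by rewrite egh.
  by rewrite -!comp_assoc wj -[- q]sub0r !compBr !comp0r !sub0r => /oppr_inj.
have [P [n hn]] := ab_ker aS w.
have hw := epic_coker_ker ew hn.
have yn : y \oc p1 \oc n = q \oc p2 \oc n.
  by apply/eqP; rewrite -subr_eq0 -compBl hn.1.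
have qn : q \oc p2 \oc n = 0.
  apply: hG => g; rewrite -[LHS]comp_assoc -[LHS]comp_assoc; apply: qT => v.
  rewrite -fQE -[LHS]comp_assoc [p2 \oc _]comp_assoc [q \oc _]comp_assoc.
  by rewrite [q \oc (_ \oc n)]comp_assoc -yn !comp_assoc hy !comp0l.
have [u [uE _]] := hw.2 _ (y \oc p1) (etrans yn qn).
have u0 : u = 0.
  have : u \oc (w \oc j) = 0 by rewrite comp_assoc uE -[LHS]comp_assoc p1j comp0r.
  rewrite wj -[- q]sub0r compBr comp0r sub0r => /eqP; rewrite oppr_eq0 => /eqP uq.
  by apply: (coker_epic hq); rewrite comp0l.
by rewrite -[y]comp_idr -p1i comp_assoc -uE u0 !comp0l.
Qed.

Lemma cotensoring_exists (tS : tensoring S) : inhabited (cotensoring tS).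
Proof.
have ex : forall VM : lmodType k * S,
    exists Q : {Q : S & {linear VM.1 -> hom Q VM.2}},
      forall (X : S) (x : {linear VM.1 -> hom X VM.2}),
        exists! h : hom X (projT1 Q), forall v, projT2 Q v \oc h = x v.
  by move=> [V M]; have [Q [e h]] := cot_exists M V; exists (existT _ Q e).
pose T x := projT1 (cid (ex x)).
have hT (x : lmodType k * S) (X : S) (f : {linear x.1 -> hom X x.2}) :
    exists! h : hom X (projT1 (T x)), forall v, projT2 (T x) v \oc h = f v.
  exact: (projT2 (cid (ex x))).
pose fs (V : lmodType k) (M X : S) (f : hom (ten tS X V) M) : {linear V -> hom X M} :=
  postcomp f \o ten_in tS X V.
pose cur (V : lmodType k) (M X : S) (f : hom (ten tS X V) M) := projT1 (cid (hT (V, M) X (fs V M X f))).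
have curE (V : lmodType k) (M X : S) (f : hom (ten tS X V) M) v : projT2 (T (V, M)) v \oc cur V M X f = f \oc ten_in tS X V v.
  by rewrite /cur; case: cid => g [].
pose ev (V : lmodType k) (M : S) := ten_lift tS (projT2 (T (V, M))).
constructor; apply: (@Cotensoring k S tS (fun V M => projT1 (T (V, M))) ev cur).
  move=> V M X f; apply: ten_ext => v.
  by rewrite -comp_assoc ten_mapE comp_assoc ten_liftK curE.
move=> V M X g h egh.
have [m [_ um]] := hT (V, M) X (fs V M X (ev V M \oc ten_map tS g (linid V))).
have evE (l : hom X (projT1 (T (V, M)))) v :
    ev V M \oc ten_map tS l (linid V) \oc ten_in tS X V v = projT2 (T (V, M)) v \oc l.
  by rewrite -comp_assoc ten_mapE comp_assoc ten_liftK.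
transitivity m; [apply: esym|]; apply: um => v; first by rewrite -evE.
by rewrite -evE -egh.
Qed.
End Existence.

(* Main.v *)
From HB Require Import structures.
Require Import Defs.
From mathcomp Require Import all_boot all_algebra.
Set Implicit Arguments. Unset Strict Implicit. Unset Printing Implicit Defensive.
Import GRing.Theory.
Local Open Scope ring_scope.
Local Notation hom := Defs.hom.

(** Put [Phi c = sum_i a_i (x) phi (a_i^* (x) c)]. A comodule map [f : M -> N]
    between entwined modules is averaged to
    [f~ m = sum_i f (m_0 a_i) phi (a_i^* (x) m_1)].
    Condition (ii) makes [f~] A-linear, (i) makes it C-colinear, (iii) gives
    [id~ = id], and [f |-> f~] commutes with composition by entwined maps on
    either side, so splittings in the base category can be averaged. An entwined
    contramodule is an entwined module in the opposite category, tensored by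
    [(V, -)], so the same construction serves both cases. *)

(** * Splittings from an averaging operator *)

Section Averaging.
Context {k : fieldType} {S : lincat k} {T : structure S} (Q : extra_structure T).
Local Notation car X := (st_car (ex_base X)).
Variable avg : forall {X Y : ex_obj Q}, hom (car X) (car Y) -> hom (car X) (car Y).
Hypothesis avg_hom : forall (X Y : ex_obj Q) (f : hom (car X) (car Y)),
  st_hom f -> ext_hom (avg f).
Hypothesis avg_id : forall X : ex_obj Q, avg (idm (car X)) = idm (car X).
Hypothesis avg_compl : forall (X Y Z : ex_obj Q) (g : hom (car Y) (car Z))
  (f : hom (car X) (car Y)), ext_hom g -> avg (g \oc f) = g \oc avg f.
Hypothesis avg_compr : forall (X Y Z : ex_obj Q) (f : hom (car Y) (car Z))
  (h : hom (car X) (car Y)), ext_hom h -> avg (f \oc h) = avg f \oc h.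

(** If [s] is a section of [p] in the base category, then [avg s] is one upstairs: [p \oc avg s =
    avg (p \oc s) = avg id = id]. *)
Lemma semisimple_of_averaging : semisimple (forget Q).
Proof.
move=> N M P i p ip [_ [s sp]]; split=> //.
exists (st_mk (T := extended Q) (avg_hom (st_valP s))).
apply: st_val_inj; rewrite !st_mkK -avg_compl; last exact: (@st_valP _ _ (extended Q)).
by have /(congr1 (@st_val _ _ _ _ _)) := sp; rewrite !st_mkK => ->; rewrite avg_id.
Qed.

(** A retraction [r] of [i] in the base category averages to one upstairs, since
    [avg r \oc i = avg (r \oc i) = id]; the extension of [f] is then [f \oc avg r]. *)
Lemma maschke_of_averaging : maschke (forget Q).
Proof.
move=> M' M N i f [r ri].
exists (f \oc (st_mk (T := extended Q) (avg_hom (st_valP r)) : hom M M')).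
rewrite -comp_assoc -[RHS]comp_idr; congr (_ \oc _).
apply: st_val_inj; rewrite !st_mkK -avg_compr; last exact: (@st_valP _ _ (extended Q)).
by have /(congr1 (@st_val _ _ _ _ _)) := ri; rewrite !st_mkK => ->; rewrite avg_id.
Qed.
End Averaging.

(** * Calculus of maps out of tensor objects *)

Section TensorLift.
Context {k : fieldType} {S : lincat k} (tS : tensoring S).
Implicit Types (M N P : S) (V W : lmodType k).

Fact tpurer_linear V W (w : W) : linear (fun v : V => tpure v w).
Proof. by move=> a x y; rewrite tpureDl. Qed.
Definition tpurer V W (w : W) : {linear V -> V \ox W} :=
  HB.pack (fun v : V => tpure v w)
    (GRing.isLinear.Build k V (V \ox W) *:%R _ (@tpurer_linear V W w)).

Fact tpurel_linear V W (v : V) : linear (fun w : W => tpure v w).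
Proof. by move=> a x y; rewrite tpureDr. Qed.
Definition tpurel V W (v : V) : {linear W -> V \ox W} :=
  HB.pack (fun w : W => tpure v w)
    (GRing.isLinear.Build k W (V \ox W) *:%R _ (@tpurel_linear V W v)).

Lemma lin_compE (U V W : lmodType k) (f : {linear V -> W}) (g : {linear U -> V}) x :
  (f \o g : {linear U -> W}) x = f (g x).
Proof. by []. Qed.
Lemma linidE V (v : V) : linid V v = v.
Proof. by []. Qed.
Lemma tpurerE V W (v : V) (w : W) : tpurer V w v = tpure v w.
Proof. by []. Qed.
Lemma tpurelE V W (v : V) (w : W) : tpurel W v w = tpure v w.
Proof. by []. Qed.
Lemma postcompE M N P (g : hom N P) (f : hom M N) : postcomp g f = g \oc f.
Proof. by []. Qed.
Lemma precompE M N P (g : hom N P) (f : hom M N) : precomp f g = g \oc f.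
Proof. by []. Qed.
(* Used in place of [/=], which also unfolds the tensor maps. *)
Definition linE := (lin_compE, linidE, tpurerE, tpurelE, postcompE, precompE).

Lemma eq_ten_lift M V N (F G : {linear V -> hom M N}) :
  F =1 G -> ten_lift tS F = ten_lift tS G.
Proof. by move=> e; apply: ten_ext => v; rewrite !ten_liftK. Qed.

Lemma ten_lift_map M M' V V' N (F : {linear V -> hom M N}) (g : hom M' M)
    (f : {linear V' -> V}) :
  ten_lift tS F \oc ten_map tS g f = ten_lift tS (precomp g \o (F \o f)).
Proof. by apply: ten_ext => v; rewrite -comp_assoc ten_mapE comp_assoc !ten_liftK. Qed.

Lemma comp_ten_lift M V N P (g : hom N P) (F : {linear V -> hom M N}) :
  g \oc ten_lift tS F = ten_lift tS (postcomp g \o F).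
Proof. by apply: ten_ext => v; rewrite -comp_assoc !ten_liftK. Qed.

Lemma ten_ext2 M V W N (g h : hom (ten tS M (V \ox W)) N) :
  (forall v w, g \oc ten_in tS M (V \ox W) (tpure v w) =
               h \oc ten_in tS M (V \ox W) (tpure v w)) -> g = h.
Proof.
move=> e; apply: ten_ext => x.
exact: (@tens_ext _ _ _ _ (postcomp g \o ten_in tS M _) (postcomp h \o ten_in tS M _)).
Qed.

Fact ten_curry_linear M V W N (H : {linear V \ox W -> hom M N}) :
  linear (fun w : W => ten_lift tS (H \o tpurer V w)).
Proof. by move=> a x y; apply: ten_lift_lin => v /=; rewrite tpureDr linearP. Qed.
Definition ten_curry M V W N (H : {linear V \ox W -> hom M N}) :
  {linear W -> hom (ten tS M V) N} :=
  HB.pack (fun w : W => ten_lift tS (H \o tpurer V w))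
    (GRing.isLinear.Build k W (hom (ten tS M V) N) *:%R _ (ten_curry_linear H)).

(** Trades an iterated lift on [(M (x) V) (x) W] for a single lift on [M (x) (V (x) W)], the form in
    which coassociativity applies. *)
Lemma ten_lift_curry M V W N (H : {linear V \ox W -> hom M N}) :
  ten_lift tS (ten_curry H) = ten_lift tS H \oc ten_assoc tS M V W.
Proof.
apply: ten_ext => w; apply: ten_ext => v.
by rewrite -!comp_assoc [ten_assoc _ _ _ _ \oc _]comp_assoc ten_assocE comp_assoc
  !ten_liftK.
Qed.
End TensorLift.

(** * Averaging a colinear map between entwined modules *)

Section AverageModules.
Context {k : fieldType} {S : lincat k} (tS : tensoring S).
Variables (A C : lmodType k) (a : algebra_on A) (c : coalgebra_on C) (psi : entwining a c).
Local Notation emod := (entwined_module tS psi).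
Local Notation car X := (co_car (em_comod X)).
Local Notation delta X := (co_delta (em_comod X)).
Implicit Types (X Y Z : emod).

(* Locked, since [comp_assoc] would otherwise unfold it to a composite. *)
Definition em_act X : {linear A -> hom (car X) (car X)} :=
  locked (postcomp (em_mu X) \o ten_in tS (car X) A : {linear _ -> _}).

Lemma em_actE X x : em_act X x = em_mu X \oc ten_in tS (car X) A x.
Proof. by rewrite /em_act -lock. Qed.

(** The action is a right one, so the first factor acts first and the order of composition is
    reversed. *)
Lemma em_act_mul X x y : em_act X (amul a (tpure x y)) = em_act X y \oc em_act X x.
Proof.
have /(congr1 (fun h => h \oc ten_in tS _ A y \oc ten_in tS _ A x)) := em_assoc X.
rewrite -!comp_assoc [ten_assoc _ _ _ _ \oc _]comp_assoc ten_assocE.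
rewrite [ten_map _ _ _ \oc (_ \oc _)]comp_assoc !ten_mapE comp_idr linE !em_actE => <-.
by rewrite -!comp_assoc.
Qed.

Lemma em_act_one X r : em_act X (aone a r) = (r : k) *: idm (car X).
Proof.
have := em_unit X; rewrite -comp_assoc ten_mapE comp_idr -em_actE => e.
have -> : r = (r : k) *: (1 : k^o) by rewrite /GRing.scale /= mulr1.
by rewrite !linearZ e /GRing.scale /= mulr1.
Qed.

Lemma em_hom_act X Y (f : hom (car X) (car Y)) x :
  em_hom f -> f \oc em_act X x = em_act Y x \oc f.
Proof. by move=> e; rewrite !em_actE comp_assoc e -!comp_assoc ten_mapE. Qed.

Lemma em_hom_of_act X Y (f : hom (car X) (car Y)) :
  (forall x, f \oc em_act X x = em_act Y x \oc f) -> em_hom f.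
Proof.
move=> e; apply: ten_ext => x.
by rewrite -comp_assoc -em_actE e em_actE -!comp_assoc ten_mapE.
Qed.

Fact act_precomp_bilin X P (G : {linear C -> hom (car X) P}) :
  bilin (fun x y => G y \oc em_act X x).
Proof. by split=> [y|x] r u v; rewrite linearP (compDl, compDr). Qed.
Definition act_precomp X P (G : {linear C -> hom (car X) P}) :
  {linear A \ox C -> hom (car X) P} := tlift (act_precomp_bilin G).

(** The entwining condition [(m x)_0 (x) (m x)_1 = m_0 x_psi (x) m_1^psi], where
    [psi (z (x) x) = x_psi (x) z^psi], tested against an arbitrary [G] in the comodule slot. *)
Lemma delta_act X P (G : {linear C -> hom (car X) P}) x :
  ten_lift tS G \oc delta X \oc em_act X x =
  ten_lift tS (act_precomp G \o (psi \o tpurer C x)) \oc delta X.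
Proof.
have /(congr1 (fun h => h \oc ten_in tS _ A x)) := em_entwined X.
rewrite -!comp_assoc ten_mapE -em_actE => ->.
rewrite !comp_assoc; congr (_ \oc _); apply: ten_ext => y.
rewrite ten_liftK -!comp_assoc [ten_assoc _ _ _ _ \oc _]comp_assoc ten_assocE.
rewrite ten_mapE comp_idr -[RHS]/(act_precomp G (psi (tpure y x))).
(* Both sides become maps composed with [ten_in] at [psi (y (x) x)]. The common factor cancels, and
   the remaining equality is checked on pure tensors of [A (x) C]. *)
have -> : act_precomp G (psi (tpure y x)) =
  ten_lift tS (act_precomp G) \oc ten_in tS _ _ (psi (tpure y x)) by rewrite ten_liftK.
rewrite !comp_assoc; congr (_ \oc _); apply: ten_ext2 => u v.
rewrite -!comp_assoc ten_assocVE [X in _ \oc X]comp_assoc ten_mapE.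
by rewrite -comp_assoc -em_actE ten_liftK tlift_pure !comp_assoc ten_liftK.
Qed.

Section Sandwich.
Variables (X Y : emod) (f : hom (car X) (car Y)).

Fact sandwich_bilin : bilin (fun x y => em_act Y y \oc f \oc em_act X x).
Proof. by split=> [y|x] r u v; rewrite linearP !(compDl, compDr). Qed.
(** On [x (x) y] this is the map [m |-> f (m x) y]. *)
Definition sandwich : {linear A \ox A -> hom (car X) (car Y)} := tlift sandwich_bilin.

Fact cosandwich_bilin1 x :
  bilin (fun y z => ten_in tS (car Y) C z \oc (em_act Y y \oc f \oc em_act X x)).
Proof. by split=> [z|y] r u v; rewrite linearP !(compDl, compDr). Qed.
Fact cosandwich_bilin :
  bilin (fun x (t : A \ox C) => tlift (cosandwich_bilin1 x) t).
Proof.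
split=> [t r x x'|x r t t']; last by rewrite linearP.
by apply: tlift_lin => y z; rewrite linearP !compDr.
Qed.
(** On [x (x) (y (x) z)] this is the map [m |-> f (m x) y (x) z]. *)
Definition cosandwich : {linear A \ox (A \ox C) -> hom (car X) (ten tS (car Y) C)} :=
  tlift cosandwich_bilin.

Lemma cosandwich_pure x y z :
  cosandwich (tpure x (tpure y z)) =
  ten_in tS (car Y) C z \oc (em_act Y y \oc f \oc em_act X x).
Proof. by rewrite !tlift_pure. Qed.

(** Together with [sandwich_preact], this turns the two outer multiplications on [A (x) A] into
    composition with the action on the target and on the source. *)
Lemma sandwich_postact (y : A) (t : A \ox A) :
  sandwich (tmap (linid A) (amul a) (tassoc A A A (tpure t y))) =
  em_act Y y \oc sandwich t.
Proof.
apply: (@tens_ext _ _ _ _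
  (sandwich \o (tmap (linid A) (amul a) \o (tassoc A A A \o tpurer _ y)))
  (postcomp (em_act Y y) \o sandwich)) => u v.
rewrite !linE.
by rewrite tassoc_pure tmap_pure !tlift_pure em_act_mul !comp_assoc.
Qed.

Lemma sandwich_preact (x : A) (t : A \ox A) :
  sandwich (tmap (amul a) (linid A) (tassocV A A A (tpure x t))) =
  sandwich t \oc em_act X x.
Proof.
apply: (@tens_ext _ _ _ _
  (sandwich \o (tmap (amul a) (linid A) \o (tassocV A A A \o tpurel _ x)))
  (precomp (em_act X x) \o sandwich)) => u v; rewrite !linE.
by rewrite tassocV_pure tmap_pure !tlift_pure em_act_mul !comp_assoc.
Qed.

Lemma cosandwich_assoc (t : A \ox A) (z : C) :
  cosandwich (tassoc A A C (tpure t z)) = ten_in tS (car Y) C z \oc sandwich t.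
Proof.
apply: (@tens_ext _ _ _ _ (cosandwich \o (tassoc A A C \o tpurer _ z))
  (postcomp (ten_in tS (car Y) C z) \o sandwich)) => u v; rewrite !linE.
by rewrite tassoc_pure cosandwich_pure tlift_pure.
Qed.

Hypothesis hf : comod_hom f.

(** Moves [C] past two copies of [A], one application of [psi] for each. *)
Definition entwine2 : {linear C \ox (A \ox A) -> A \ox (A \ox C)} :=
  tmap (linid A) psi \o (tassoc A C A \o (tmap psi (linid A) \o tassocV C A A)).

(** To compute the coaction of [f (m x) y], the entwining condition in [Y] passes [y], colinearity
    of [f] carries the coaction to the source, and the entwining condition in [X] passes [x]. The
    two entwinings together are [entwine2]. *)
Lemma delta_sandwich t :
  delta Y \oc sandwich t = ten_curry tS (cosandwich \o entwine2) t \oc delta X.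
Proof.
apply: (@tens_ext _ _ _ _ (postcomp (delta Y) \o sandwich)
  (precomp (delta X) \o ten_curry tS (cosandwich \o entwine2))) => x y; rewrite !linE.
rewrite tlift_pure.
(* Writing the identity of [Y (x) C] as a lift gives [delta Y] the shape that [delta_act]
   expects. *)
have lift_in : ten_lift tS (ten_in tS (car Y) C) = idm _.
  by apply: ten_ext => z; rewrite ten_liftK comp_idl.
rewrite -[delta Y]comp_idl -lift_in !comp_assoc delta_act.
rewrite -[_ \oc delta Y \oc f]comp_assoc hf comp_assoc ten_lift_map delta_act.
congr (_ \oc _); apply: eq_ten_lift => z; rewrite !linE.
rewrite tassocV_pure tmap_pure.
apply: (@tens_ext _ _ _ _
  (act_precomp (precomp f \o
    (act_precomp (ten_in tS (car Y) C) \o (psi \o tpurer C y) \o linid C)))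
  (cosandwich \o (tmap (linid A) psi \o (tassoc A C A \o tpurer _ y)))) => u v; rewrite !linE.
rewrite tassoc_pure tmap_pure tlift_pure; rewrite !linE.
(* The element [psi (v (x) y)] is generalized to any tensor in [A (x) C], so that pure tensors
   suffice. *)
suff e : precomp (em_act X u) \o (precomp f \o act_precomp (ten_in tS (car Y) C)) =1
    cosandwich \o tpurel _ u by exact: e.
apply: tens_ext => {}y w; rewrite !linE.
by rewrite cosandwich_pure tlift_pure !comp_assoc.
Qed.
End Sandwich.

Lemma sandwich_id X t : sandwich (idm (car X)) t = em_act X (amul a t).
Proof.
apply: (@tens_ext _ _ _ _ (sandwich (idm (car X))) (em_act X \o amul a)) => u v.
by rewrite !linE tlift_pure em_act_mul comp_idr.
Qed.

Lemma sandwich_compl X Y Z (g : hom (car Y) (car Z)) (f : hom (car X) (car Y)) t :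
  em_hom g -> sandwich (g \oc f) t = g \oc sandwich f t.
Proof.
move=> hg; apply: (@tens_ext _ _ _ _ (sandwich (g \oc f))
  (postcomp g \o sandwich f)) => u v.
by rewrite !linE !tlift_pure !comp_assoc (em_hom_act v hg).
Qed.

Lemma sandwich_compr X Y Z (f : hom (car Y) (car Z)) (h : hom (car X) (car Y)) t :
  em_hom h -> sandwich (f \oc h) t = sandwich f t \oc h.
Proof.
move=> hh; apply: (@tens_ext _ _ _ _ (sandwich (f \oc h))
  (precomp h \o sandwich f)) => u v.
by rewrite !linE !tlift_pure -!comp_assoc (em_hom_act u hh).
Qed.

Variable Phi : {linear C -> A \ox A}.

(** Writing [Phi z = z' (x) z''], this is [m |-> f (m_0 m_1') m_1'']. *)
Definition average X Y (f : hom (car X) (car Y)) : hom (car X) (car Y) :=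
  ten_lift tS (sandwich f \o Phi) \oc delta X.

Lemma average_compl X Y Z (g : hom (car Y) (car Z)) (f : hom (car X) (car Y)) :
  em_hom g -> average (g \oc f) = g \oc average f.
Proof.
move=> hg; rewrite /average comp_assoc comp_ten_lift; congr (_ \oc _).
by apply: eq_ten_lift => z; rewrite !linE sandwich_compl.
Qed.

Lemma average_compr X Y Z (f : hom (car Y) (car Z)) (h : hom (car X) (car Y)) :
  comod_hom h -> em_hom h -> average (f \oc h) = average f \oc h.
Proof.
move=> ch hh; rewrite /average -[RHS]comp_assoc ch comp_assoc ten_lift_map.
by congr (_ \oc _); apply: eq_ten_lift => z; rewrite !linE sandwich_compr.
Qed.

(** Conditions (iii), (ii) and (i) of a normalized cointegral, expressed through [Phi] without the
    dual of [A]. The second reads [Phi(z) x = x_psi Phi(z^psi)]. *)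
Hypothesis Phi_norm : amul a \o Phi =1 aone a \o ceps c.
Hypothesis Phi_mul : forall z x,
  tmap (linid A) (amul a) (tassoc A A A (tpure (Phi z) x)) =
  tmap (amul a) (linid A) (tassocV A A A (tmap (linid A) Phi (psi (tpure z x)))).
Hypothesis Phi_comul : forall z,
  entwine2 (tmap (linid C) Phi (cmul c z)) = tassoc A A C (tmap Phi (linid C) (cmul c z)).

(** For the identity, the two actions merge into that of [m_1' m_1'' = eps(m_1) 1], and the counit
    axiom leaves [m]. *)
Lemma average_id X : average (idm (car X)) = idm (car X).
Proof.
rewrite -[RHS]co_counit /average ten_lift_map; congr (_ \oc _).
apply: eq_ten_lift => z; rewrite !linE sandwich_id comp_idr.
by have /= -> := Phi_norm z; rewrite em_act_one.
Qed.

(** By [delta_act], evaluating at [m x] replaces [Phi(m_1)] by [x_psi Phi(m_1^psi)], which is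
    [Phi(m_1) x] by [Phi_mul]; the right factor [x] then acts on the target. *)
Lemma average_em_hom X Y (f : hom (car X) (car Y)) : em_hom (average f).
Proof.
apply: em_hom_of_act => x; rewrite /average delta_act comp_assoc comp_ten_lift.
congr (_ \oc _); apply: eq_ten_lift => z; rewrite !linE -sandwich_postact Phi_mul.
apply: (@tens_ext _ _ _ _ (act_precomp (sandwich f \o Phi))
  (sandwich f \o (tmap (amul a) (linid A) \o (tassocV A A A \o tmap (linid A) Phi))))
  => u v.
by rewrite !linE tmap_pure sandwich_preact tlift_pure.
Qed.

(** Both sides apply [cosandwich f] to [m_0]: the coaction of the average uses
    [entwine2 (m_1 (x) Phi(m_2))], the average tensored with [C] uses [Phi(m_1) (x) m_2]. These
    agree by [Phi_comul]. *)
Lemma average_comod_hom X Y (f : hom (car X) (car Y)) :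
  comod_hom f -> comod_hom (average f).
Proof.
move=> hf; rewrite /comod_hom /average comp_assoc comp_ten_lift.
pose H := cosandwich f \o entwine2 : {linear _ -> _}.
pose K := cosandwich f \o (tassoc A A C \o tmap Phi (linid C)) : {linear _ -> _}.
have -> : ten_lift tS (postcomp (delta Y) \o (sandwich f \o Phi)) =
    ten_lift tS (ten_curry tS (H \o tmap (linid C) Phi)) \oc
      ten_map tS (delta X) (linid C).
  rewrite ten_lift_map; apply: eq_ten_lift => z; rewrite !linE delta_sandwich //.
  congr (_ \oc _); apply: eq_ten_lift => w; rewrite !linE tmap_pure.
  by rewrite !linE.
have -> : ten_map tS (ten_lift tS (sandwich f \o Phi) \oc delta X) (linid C) =
    ten_lift tS (ten_curry tS K) \oc ten_map tS (delta X) (linid C).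
  rewrite ten_map_compl; congr (_ \oc _); apply: eq_ten_lift => z; rewrite !linE.
  rewrite comp_ten_lift; apply: eq_ten_lift => w; rewrite !linE tmap_pure.
  by rewrite cosandwich_assoc.
(* Coassociativity replaces the iterated coaction by [cmul c], which reduces the claim to an
   identity at each [z] in [C]. *)
rewrite !ten_lift_curry -!comp_assoc [ten_assoc _ _ _ _ \oc _]comp_assoc co_assoc.
rewrite !comp_assoc !ten_lift_map; congr (_ \oc _); apply: eq_ten_lift => z.
by rewrite /H /K !linE; congr (cosandwich f _ \oc _); exact: Phi_comul.
Qed.
End AverageModules.

(** * Cointegral conditions (i) and (ii) restated for [Phi] *)

Section CointegralMap.
Context {k : fieldType}.

Lemma tmap_assocV (U V V' W W' : lmodType k) (g : {linear U \ox V -> V'})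
    (f : {linear W -> W'}) x s :
  tmap g f (tassocV U V W (tpure x s)) =
  tmap g (linid W') (tassocV U V W' (tpure x (tmap (linid V) f s))).
Proof.
apply: (@tens_ext _ _ _ _ (tmap g f \o (tassocV U V W \o tpurel _ x))
  (tmap g (linid W') \o (tassocV U V W' \o (tpurel _ x \o tmap (linid V) f)))) => v w.
by rewrite !linE !(tmap_pure, tassocV_pure).
Qed.

(** The coevaluation is inserted to the left of [V], so a map consuming the dual and [V] leaves [W]
    as a spectator. *)
Lemma coevl_tpure (A : vectType k) (U V W : lmodType k) (f : {linear dual A \ox V -> U}) v w :
  tmap (linid A) (tmap f (linid W) \o tassocV (dual A) V W) (coevl A (V \ox W) (tpure v w)) =
  tassoc A U W (tpure (tmap (linid A) f (coevl A V v)) w).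
Proof.
rewrite -[coevl A _ _]/(tassoc _ _ _ (tmap (coev A) (linid _) (tpure 1 (tpure v w)))).
rewrite -[coevl A _ _]/(tassoc _ _ _ (tmap (coev A) (linid _) (tpure 1 v))).
(* Both sides are linear in the coevaluation element, so it is generalized to an arbitrary tensor
   and checked on pure ones. *)
rewrite !tmap_pure !linE; move: (coev A 1) => t.
apply: (@tens_ext _ _ _ _
  (tmap (linid A) (tmap f (linid W) \o tassocV (dual A) V W) \o
    (tassoc A (dual A) (V \ox W) \o tpurer _ (tpure v w)))
  (tassoc A U W \o (tpurer _ w \o (tmap (linid A) f \o
    (tassoc A (dual A) V \o tpurer _ v))))) => x y.
by rewrite !linE !(tmap_pure, tassoc_pure, tassocV_pure, linE).
Qed.

Variables (A : vectType k) (C : lmodType k) (a : algebra_on A) (c : coalgebra_on C).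
Variables (psi : entwining a c) (phi : {linear dual A \ox C -> A}).
Hypothesis hphi : normalized_cointegral psi phi.

Definition cointegral_map : {linear C -> A \ox A} := tmap (linid A) phi \o coevl A C.

(** This is (ii): its left side is rebracketed by [coevl_tpure], and on its right side [tmap_assocV]
    applies [phi] before the multiplication. *)
Lemma cointegral_map_mul z x :
  tmap (linid A) (amul a) (tassoc A A A (tpure (cointegral_map z) x)) =
  tmap (amul a) (linid A)
    (tassocV A A A (tmap (linid A) cointegral_map (psi (tpure z x)))).
Proof.
have e := cointegral_mul hphi (tpure z x).
rewrite -[cointegral_map z]/(tmap (linid A) phi (coevl A C z)) -coevl_tpure.
etransitivity; first exact: e.
apply: (@tens_ext _ _ _ _
  (tmap (amul a) phi \o (tassocV A A (dual A \ox C) \o tmap (linid A) (coevl A C)))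
  (tmap (amul a) (linid A) \o (tassocV A A A \o tmap (linid A) cointegral_map))) => u v.
by rewrite !linE !tmap_pure !linE tmap_assocV.
Qed.

(** This is (i): [tmap_assocV] separates [phi] from [psi] on the left, and [coevl_tpure] rebrackets
    the right. *)
Lemma cointegral_map_comul z :
  entwine2 psi (tmap (linid C) cointegral_map (cmul c z)) =
  tassoc A A C (tmap cointegral_map (linid C) (cmul c z)).
Proof.
have e := cointegral_comul hphi z.
transitivity ((tmap (linid A) psi \o (tassoc A C A \o (tmap psi phi \o
  (tassocV C A (dual A \ox C) \o tmap (linid C) (coevl A C))))) (cmul c z)).
  apply: (@tens_ext _ _ _ _
    (entwine2 psi \o tmap (linid C) cointegral_map)
    (tmap (linid A) psi \o (tassoc A C A \o (tmap psi phi \o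
      (tassocV C A (dual A \ox C) \o tmap (linid C) (coevl A C)))))) => u v.
  by rewrite !linE !tmap_pure [in RHS]tmap_assocV.
etransitivity; first exact: e.
apply: (@tens_ext _ _ _ _
  (tmap (linid A) (tmap phi (linid C) \o tassocV (dual A) C C) \o coevl A (C \ox C))
  (tassoc A A C \o tmap cointegral_map (linid C))) => u v.
by rewrite !linE coevl_tpure !tmap_pure !linE.
Qed.
End CointegralMap.

(** * Contramodules as comodules in the opposite category *)

Section Opposite.
Context {k : fieldType} {S : lincat k} {tS : tensoring S} (cS : cotensoring tS).

Fact op_comp_assoc (X Y Z W : S) (h : hom W Z) (g : hom Z Y) (f : hom Y X) :
  (f \oc g) \oc h = f \oc (g \oc h).
Proof. by rewrite comp_assoc. Qed.
Definition opcat : lincat k :=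
  @LinCat k S (fun X Y => hom Y X) (fun X => idm X) (fun X Y Z g f => f \oc g)
    op_comp_assoc (fun X Y f => comp_idr f) (fun X Y f => comp_idl f)
    (fun X Y Z f => comp_linr f) (fun X Y Z g => comp_linl g).
Definition optens : tensoring opcat :=
  @Tensoring k opcat (fun M V => cot cS V M) (fun M V => cot_at cS V M)
    (fun M V N F => cot_lift cS F) (fun M V N F => cot_liftK cS F)
    (fun M V N g h => @cot_ext k S tS cS N V M g h).

Lemma op_ten_map (M N : opcat) (V W : lmodType k) (g : hom M N) (f : {linear V -> W}) :
  ten_map optens g f = cot_map cS f (g : @Defs.hom k S N M).
Proof.
apply: (@ten_ext _ _ optens) => v; rewrite ten_mapE.
by rewrite [RHS](cot_mapE cS f (g : @Defs.hom k S N M) v).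
Qed.

(** The factors swap because [(M (x) V) (x) W] is [(W, (V, M))] here; the reversed arrow makes the
    associator correspond to the inverse one. *)
Lemma op_ten_assoc (M : opcat) (V W : lmodType k) :
  ten_assoc optens M V W = cot_assocV cS W V M.
Proof.
apply: (@ten_ext _ _ optens) => w; apply: (@ten_ext _ _ optens) => v.
by rewrite ten_assocE -[LHS](cot_assocVE cS M v w).
Qed.

Lemma op_ten_assocV (M : opcat) (V W : lmodType k) :
  ten_assocV optens M V W = cot_assoc cS W V M.
Proof.
apply: ten_ext2 => v w.
by rewrite ten_assocVE [RHS](cot_assocE cS M v w).
Qed.

Lemma op_ten_unit (M : opcat) : ten_unit optens M = cot_unit cS M.
Proof.
apply: (@ten_ext _ _ optens) => r.
by rewrite ten_liftK [RHS](cot_liftK cS (scale_id (M : S)) r).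
Qed.

Variables (A C : lmodType k) (a : algebra_on A) (c : coalgebra_on C) (psi : entwining a c).

(** The contraaction [(C, M) -> M], read backwards, is a coaction. The definition is transparent so
    that carriers and structure maps compute. *)
Definition op_comodule (X : contramodule c cS) : comodule optens c.
Proof.
apply: (@Comodule k opcat optens C c (cm_car X) (cm_pi X)).
  rewrite op_ten_map op_ten_unit.
  exact: etrans (@comp_assoc k S _ _ _ _ _ _ _) (cm_counit X).
rewrite !op_ten_map op_ten_assoc /=.
(* The two associativity axioms place the associator on opposite sides, so it cancels against its
   inverse. *)
by rewrite comp_assoc -cm_assoc -[LHS]comp_assoc cot_assocVK comp_idr.
Defined.

Definition op_entwined (X : entwined_contramodule psi cS) : entwined_module optens psi.
Proof.
apply: (@EntwinedModule k opcat optens A C a c psi (op_comodule (ec_contra X)) (ec_mu X)).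
- rewrite !op_ten_map op_ten_assoc /=.
  by rewrite (ec_assoc X) !comp_assoc cot_assocK comp_idl.
- rewrite op_ten_map /= (ec_unit X).
  by rewrite [LHS](cot_liftK cS (scale_id (cm_car (ec_contra X))) 1) /= scale1r.
by rewrite !op_ten_map op_ten_assoc op_ten_assocV /= ec_entwined !comp_assoc.
Defined.

Lemma op_comod_hom (X Y : contramodule c cS) (f : hom (cm_car X) (cm_car Y)) :
  @comod_hom _ _ optens C c (op_comodule Y) (op_comodule X) f <-> contra_hom f.
Proof. by rewrite /comod_hom op_ten_map. Qed.

Lemma op_em_hom (X Y : entwined_contramodule psi cS)
    (f : hom (cm_car (ec_contra X)) (cm_car (ec_contra Y))) :
  @em_hom _ _ optens A C a c psi (op_entwined Y) (op_entwined X) f <-> ec_hom f.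
Proof. by rewrite /em_hom op_ten_map; split=> e; apply: esym. Qed.
End Opposite.

(** * Averaging in the opposite category for contramodules, and in [S] for comodules *)

Theorem theorem5 (k : fieldType) (char0 : [pchar k] =i pred0)
    (S : lincat k) (grothS : grothendieck S)
    (tS : tensoring S) (cS : cotensoring tS)
    (A : vectType k) (C : lmodType k) (a : algebra_on A) (c : coalgebra_on C)
    (exactC : exact_functor (cot_functor cS C))
    (psi : entwining a c) (phi : {linear dual A \ox C -> A})
    (cointphi : normalized_cointegral psi phi) :
  (semisimple (contra_forget psi cS) /\ maschke (contra_forget psi cS)) /\
  (semisimple (comod_forget tS psi) /\ maschke (comod_forget tS psi)).
Proof.
pose Phi := cointegral_map phi.
have Phi_norm : amul a \o Phi =1 aone a \o ceps c := cointegral_norm cointphi.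
have Phi_mul := cointegral_map_mul cointphi.
have Phi_comul := cointegral_map_comul cointphi.
split.
  pose car X := cm_car (@ec_contra k S tS A C a c psi cS X).
  (* A map from [X] to [Y] in [S] goes from [Y] to [X] in the opposite category, hence the swapped
     arguments. *)
  pose avg X Y (f : hom (car X) (car Y)) : hom (car X) (car Y) :=
    @average _ _ (optens cS) A C a c psi Phi (op_entwined Y) (op_entwined X) f.
  have avg_hom X Y (f : hom (car X) (car Y)) :
      contra_hom f -> @ext_hom _ _ _ (ec_structure psi cS) X Y (avg X Y f).
    move=> hf; split; last exact/op_em_hom/(average_em_hom Phi_mul).
    apply/op_comod_hom.
    by apply: (average_comod_hom Phi_comul (X := op_entwined Y) (Y := op_entwined X));
      apply/op_comod_hom.
  have avg_id X : avg X X (idm _) = idm _ by exact: (average_id _ (op_entwined X)).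
  (* Postcomposition in [S] is precomposition in the opposite category, so [average_compr] and
     [average_compl] exchange roles. *)
  have avg_compl X Y Z (g : hom (car Y) (car Z)) (f : hom (car X) (car Y)) :
      @ext_hom _ _ _ (ec_structure psi cS) Y Z g -> avg X Z (g \oc f) = g \oc avg X Y f.
    move=> [/op_comod_hom cg /op_em_hom hg].
    exact: (average_compr Phi (X := op_entwined Z) (Y := op_entwined Y)
      (Z := op_entwined X) f cg hg).
  have avg_compr X Y Z (f : hom (car Y) (car Z)) (h : hom (car X) (car Y)) :
      @ext_hom _ _ _ (ec_structure psi cS) X Y h -> avg X Z (f \oc h) = avg Y Z f \oc h.
    move=> [_ /op_em_hom hh].
    exact: (average_compl Phi (X := op_entwined Z) (Y := op_entwined Y)
      (Z := op_entwined X) f hh).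
  split.
    exact: (semisimple_of_averaging (Q := ec_structure psi cS) avg_hom avg_id avg_compl).
  exact: (maschke_of_averaging (Q := ec_structure psi cS) avg_hom avg_id avg_compr).
pose car X := co_car (@em_comod k S tS A C a c psi X).
pose avg X Y (f : hom (car X) (car Y)) : hom (car X) (car Y) := average Phi f.
have avg_hom X Y (f : hom (car X) (car Y)) :
    comod_hom f -> @ext_hom _ _ _ (em_structure tS psi) X Y (avg X Y f).
  by move=> hf; split; [exact: average_comod_hom | exact: average_em_hom].
have avg_id X : avg X X (idm _) = idm _ by exact: average_id.
have avg_compl X Y Z (g : hom (car Y) (car Z)) (f : hom (car X) (car Y)) :
    @ext_hom _ _ _ (em_structure tS psi) Y Z g -> avg X Z (g \oc f) = g \oc avg X Y f.
  by move=> [_ hg]; exact: average_compl.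
have avg_compr X Y Z (f : hom (car Y) (car Z)) (h : hom (car X) (car Y)) :
    @ext_hom _ _ _ (em_structure tS psi) X Y h -> avg X Z (f \oc h) = avg Y Z f \oc h.
  by move=> [ch hh]; exact: average_compr.
split.
  exact: (semisimple_of_averaging (Q := em_structure tS psi) avg_hom avg_id avg_compl).
exact: (maschke_of_averaging (Q := em_structure tS psi) avg_hom avg_id avg_compr).
Qed.
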